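(* Let $K$ be a field of characteristic zero, let $n\ge 2$, and let $0\neq\lambda\in K$. Let $C\in K[x_1,\ldots,x_{n+1}]$ be an arbitrary non-constant homogeneous closed polynomial. Then the $n$-Lie-Poisson algebra $S_C[x_1,\ldots,x_{n+1}]=P_C[x_1,\ldots,x_{n+1}]/(C-\lambda)$ is a central simple $n$-Lie-Poisson algebra over $K$.
   Context: An $n$-Lie-Poisson algebra over $K$ is a commutative associative $K$-algebra $P$ with an $n$-ary multilinear skew-symmetric bracket $\{\cdot,\ldots,\cdot\}$ that is a derivation of the associative product in each argument (Leibniz identity) and satisfies the $n$-Lie Jacobi identity $\{\{u_1,\ldots,u_n\},v_1,\ldots,v_{n-1}\}=\sum_{i=1}^n\{u_1,\ldots,u_{i-1},\{u_i,v_1,\ldots,v_{n-1}\},u_{i+1},\ldots,u_n\}$. For $C\in K[x_1,\ldots,x_{n+1}]$, $P_C[x_1,\ldots,x_{n+1}]$ denotes the polynomial algebra $K[x_1,\ldots,x_{n+1}]$ with the $n$-ary bracket $\{f_1,\ldots,f_n\}=J(f_1,\ldots,f_n,C)$, where $J(g_1,\ldots,g_{n+1})=\det[\partial g_i/\partial x_j]$ is the Jacobian; this is an $n$-Lie-Poisson algebra and $C$ lies in its center. $S_C[x_1,\ldots,x_{n+1}]$ denotes the quotient of $P_C[x_1,\ldots,x_{n+1}]$ by the ideal $(C-\lambda)$ of the polynomial algebra generated by $C-\lambda$, with the induced bracket. A polynomial $g\in K[x_1,\ldots,x_{n+1}]$ is closed if $K[g]$ is integrally closed in $K[x_1,\ldots,x_{n+1}]$.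 (A non-constant homogeneous $C$ is closed if and only if it cannot be written as $C=\alpha c^t$ with $\alpha\in K$, $c\in K[x_1,\ldots,x_{n+1}]$, $t\ge 2$.) The center $Z(P)$ of an $n$-Lie-Poisson algebra $P$ is the set of all $c\in P$ with $\{c,f_2,\ldots,f_n\}=0$ for all $f_2,\ldots,f_n\in P$. $P$ is central over $K$ if $Z(P)=K$. $P$ is simple if the only ideals $I$ of the commutative associative algebra $P$ satisfying $\{P,\ldots,P,I\}\subseteq I$ are $0$ and $P$. *)

(* Defs.v *)
From HB Require Import structures.
From mathcomp Require Import all_boot all_order perm all_algebra.
From mathcomp Require Import boolp.
From mathcomp Require Import mpoly.

Set Implicit Arguments.
Unset Strict Implicit.
Unset Printing Implicit Defensive.

Import GRing.Theory.
Local Open Scope ring_scope.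
Local Open Scope quotient_scope.

Definition setarg (n : nat) (P : Type) (u : {ffun 'I_n -> P}) (i : 'I_n)
    (x : P) : {ffun 'I_n -> P} :=
  [ffun j => if j == i then x else u j].

(* The n - 1 arguments v_1, ..., v_{n-1} of {x, v_1, ..., v_{n-1}} are given
   as a full family v whose entry at i0 = 0 is overwritten by x. *)
Record is_nLiePoisson (n : nat) (K : fieldType) (P : comAlgType K)
    (br : {ffun 'I_n -> P} -> P) : Prop := {
  br_linear : forall (u : {ffun 'I_n -> P}) (i : 'I_n) (a : K) (x y : P),
    br (setarg u i (a *: x + y)) = a *: br (setarg u i x) + br (setarg u i y);
  br_skew : forall (u : {ffun 'I_n -> P}) (s : 'S_n),
    br [ffun i => u (s i)] = (-1) ^+ s * br u;
  br_leibniz : forall (u : {ffun 'I_n -> P}) (i : 'I_n) (x y : P),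
    br (setarg u i (x * y)) = x * br (setarg u i y) + br (setarg u i x) * y;
  br_jacobi : forall (u v : {ffun 'I_n -> P}) (i0 : 'I_n), i0 = 0%N :> nat ->
    br (setarg v i0 (br u)) =
      \sum_(i < n) br (setarg u i (br (setarg v i0 (u i))))
}.

Definition in_center (n : nat) (K : fieldType) (P : comAlgType K)
    (br : {ffun 'I_n -> P} -> P) (c : P) : Prop :=
  forall (u : {ffun 'I_n -> P}) (i0 : 'I_n), i0 = 0%N :> nat ->
    br (setarg u i0 c) = 0.

Definition is_central (n : nat) (K : fieldType) (P : comAlgType K)
    (br : {ffun 'I_n -> P} -> P) : Prop :=
  forall c : P, in_center br c <-> exists a : K, c = a%:A.

Record is_ideal (P : comNzRingType) (I : P -> Prop) : Prop := {
  ideal_0 : I 0;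
  ideal_D : forall x y : P, I x -> I y -> I (x + y);
  ideal_M : forall a x : P, I x -> I (a * x)
}.

Definition is_simple (n : nat) (K : fieldType) (P : comAlgType K)
    (br : {ffun 'I_n -> P} -> P) : Prop :=
  forall I : P -> Prop,
    is_ideal I ->
    (forall (u : {ffun 'I_n -> P}) (i1 : 'I_n),
       i1 = n.-1 :> nat -> I (u i1) -> I (br u)) ->
    (forall x : P, I x -> x = 0) \/ (forall x : P, I x).

Definition jacobian (m : nat) (K : fieldType) (g : 'I_m -> {mpoly K[m]}) :
    {mpoly K[m]} :=
  \det (\matrix_(i < m, j < m) (g i)^`M(j)).

(* unlift ord_max i is Some of i itself (as an element of 'I_n) for i < n,
   and None for i = n: the rows of the Jacobian are f_1, ..., f_n, C. *)
Definition P_bracket (n : nat) (K : fieldType) (C : {mpoly K[n.+1]})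
    (f : {ffun 'I_n -> {mpoly K[n.+1]}}) : {mpoly K[n.+1]} :=
  jacobian (fun i : 'I_n.+1 => oapp f C (unlift ord_max i)).

(* horner_alg g : {poly K} -> {mpoly K[m]} is p |-> p(g), with image K[g]. *)
Definition closed_mpoly (m : nat) (K : fieldType) (g : {mpoly K[m]}) : Prop :=
  forall f : {mpoly K[m]}, integralOver (horner_alg g) f ->
    exists p : {poly K}, f = horner_alg g p.

Definition nonconstant (m : nat) (K : fieldType) (C : {mpoly K[m]}) : Prop :=
  forall c : K, C != c%:MP.

(* The ideal (C - lambda); the unused proof of nonconstancy makes it proper,
   which the quotient construction requires. *)
Definition level_ideal (m : nat) (K : fieldType) (C : {mpoly K[m]})
    (lambda : K) (hC : nonconstant C) : {pred {mpoly K[m]}} :=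
  fun f => `[< exists h : {mpoly K[m]}, f = h * (C - lambda%:MP) >].

Section Quotient.
Variables (m : nat) (K : fieldType) (C : {mpoly K[m]}) (lambda : K).
Variable hC : nonconstant C.

Lemma level_ideal_closed : idealr_closed (level_ideal lambda hC).
Proof.
split=> [||a u v /asboolP[h ->] /asboolP[k ->]].
- by apply/asboolP; exists 0; rewrite mul0r.
- apply/negP => /asboolP[h h1].
  have : (C - lambda%:MP) \is a GRing.unit.
    by apply/unitrPr; exists h; rewrite mulrC -h1.
  rewrite unfold_in /= => /andP[/eqP e _].
  have := hC ((C - lambda%:MP)@_0%MM + lambda).
  by rewrite mpolyCD -e subrK eqxx.
- by apply/asboolP; exists (a * h + k); rewrite mulrDl mulrA.
Qed.

HB.instance Definition _ :=
  isIdealr.Build {mpoly K[m]} (level_ideal lambda hC) level_ideal_closed.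

Definition level_quot : Type := {ideal_quot (level_ideal lambda hC)}.

HB.instance Definition _ := GRing.ComNzRing.on level_quot.
HB.instance Definition _ := NzRingQuotient.on level_quot.

Definition level_proj (f : {mpoly K[m]}) : level_quot := \pi f.

Lemma level_proj_zmod : zmod_morphism level_proj.
Proof. exact: (rmorphB \pi_({ideal_quot (level_ideal lambda hC)})). Qed.

Lemma level_proj_monoid : monoid_morphism level_proj.
Proof.
split; first exact: (rmorph1 \pi_({ideal_quot (level_ideal lambda hC)})).
exact: (rmorphM \pi_({ideal_quot (level_ideal lambda hC)})).
Qed.

HB.instance Definition _ :=
  GRing.isZmodMorphism.Build {mpoly K[m]} level_quot level_proj level_proj_zmod.
HB.instance Definition _ := GRing.isMonoidMorphism.Build {mpoly K[m]} level_quot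
  level_proj level_proj_monoid.

Lemma level_proj_eq (f g : {mpoly K[m]}) :
  (level_proj f == level_proj g) = (f - g \in level_ideal lambda hC).
Proof. by rewrite Quotient.idealrBE. Qed.

Definition level_scale (a : K) (x : level_quot) : level_quot :=
  level_proj a%:MP * x.

Lemma level_scalerA a b x : level_scale a (level_scale b x) = level_scale (a * b) x.
Proof. by rewrite /level_scale mulrA -rmorphM -mpolyCM. Qed.

Lemma level_scale1r : left_id 1 level_scale.
Proof. by move=> x; rewrite /level_scale mpolyC1 rmorph1 mul1r. Qed.

Lemma level_scalerDr : right_distributive level_scale +%R.
Proof. by move=> a x y; rewrite /level_scale mulrDr. Qed.

Lemma level_scalerDl x : {morph level_scale^~ x : a b / a + b}.
Proof. by move=> a b; rewrite /level_scale mpolyCD rmorphD mulrDl. Qed.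

HB.instance Definition _ := GRing.Zmodule_isLmodule.Build K level_quot
  level_scalerA level_scale1r level_scalerDr level_scalerDl.

Lemma level_scalerAl (a : K) (x y : level_quot) : a *: (x * y) = (a *: x) * y.
Proof. exact: mulrA. Qed.

HB.instance Definition _ :=
  GRing.Lmodule_isLalgebra.Build K level_quot level_scalerAl.
HB.instance Definition _ := GRing.Lalgebra_isComAlgebra.Build K level_quot.

End Quotient.

(* The induced bracket; S_bracketE shows that it does not depend on the choice
   of representatives. *)
Definition S_bracket (n : nat) (K : fieldType) (C : {mpoly K[n.+1]})
    (lambda : K) (hC : nonconstant C)
    (u : {ffun 'I_n -> level_quot lambda hC}) : level_quot lambda hC :=
  level_proj lambda hC (P_bracket C [ffun i => repr (u i)]).

Lemma P_bracket_congr (n : nat) (K : fieldType) (C : {mpoly K[n.+1]})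
    (lambda : K) (hC : nonconstant C) (f g : {ffun 'I_n -> {mpoly K[n.+1]}}) :
  (forall i, level_proj lambda hC (f i) = level_proj lambda hC (g i)) ->
  level_proj lambda hC (P_bracket C f) = level_proj lambda hC (P_bracket C g).
Proof.
move=> efg.
have /fin_all_exists[h hP] i :
    exists h : {mpoly K[n.+1]}, f i = g i + h * (C - lambda%:MP).
  have /eqP := efg i; rewrite level_proj_eq => /asboolP[h e].
  by exists h; rewrite -e addrC subrK.
have C0 : level_proj lambda hC (C - lambda%:MP) = 0.
  apply/eqP; rewrite -(rmorph0 (level_proj lambda hC)) level_proj_eq subr0.
  by apply/asboolP; exists 1; rewrite mul1r.
pose U : 'M[{mpoly K[n.+1]}]_n.+1 := \matrix_(i, j)
  ((i == j)%:R + (j == ord_max)%:R * oapp h 0 (unlift ord_max i)).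
have detU : \det U = 1.
  rewrite -det_tr det_trig; last first.
    apply/is_trig_mxP => i j lt_ij; rewrite !mxE.
    have -> : (j == i) = false by apply/eqP => e; rewrite e ltnn in lt_ij.
    have -> : (i == ord_max) = false.
      by apply/eqP => e; rewrite e ltnNge -ltnS ltn_ord in lt_ij.
    by rewrite mul0r addr0.
  apply: big1 => i _; rewrite !mxE eqxx.
  by case: unliftP => [k ->|->] /=; rewrite ?mulr0 ?addr0 //
    eq_sym (negPf (neq_lift _ _)) mul0r addr0.
rewrite /P_bracket /jacobian.
set A := \matrix_(_, _) _; set B := \matrix_(_, _) _.
rewrite -[in RHS](mul1r (\det B)) -detU -det_mulmx -!det_map_mx.
congr (\det _); apply/matrixP => i j.
rewrite !mxE (bigD1 ord_max) //= !mxE unlift_none /= eqxx mul1r.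
case: (unliftP ord_max i) => [k ->|->] /=.
  rewrite (bigD1 (lift ord_max k)) 1?eq_sym ?neq_lift //= !mxE liftK /=.
  rewrite big1 => [|l /andP[l1 l2]]; last first.
    by rewrite !mxE eq_sym (negPf l2) (negPf l1) mul0r addr0 mul0r.
  have ne := negPf (neq_lift (@ord_max n) k).
  rewrite eqxx ?(eq_sym (lift _ _)) ne mul0r !addr0 mul1r add0r hP.
  rewrite mderivD mderivM mderivB mderivC subr0.
  set D := C - _ in C0 *.
  by rewrite !rmorphD !rmorphM /= C0 mulr0 add0r addrC.
rewrite eqxx addr0 mul1r big1 ?addr0 // => l l1.
by rewrite !mxE eq_sym (negPf l1) mul0r addr0 mul0r.
Qed.

Lemma S_bracketE (n : nat) (K : fieldType) (C : {mpoly K[n.+1]})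
    (lambda : K) (hC : nonconstant C) (f : {ffun 'I_n -> {mpoly K[n.+1]}}) :
  S_bracket [ffun i => level_proj lambda hC (f i)] =
  level_proj lambda hC (P_bracket C f).
Proof.
apply: P_bracket_congr => i; rewrite !ffunE.
exact: (reprK (level_proj lambda hC (f i) : {ideal_quot _})).
Qed.

(* Main.v *)
Require Import Defs.
From HB Require Import structures.
From mathcomp Require Import all_boot all_order perm all_algebra.
From mathcomp Require Import boolp ring zify.
From mathcomp Require Import mpoly.

Set Implicit Arguments.
Unset Strict Implicit.
Unset Printing Implicit Defensive.

Import Order.Theory GRing.Theory.
Local Open Scope ring_scope.

(** Write R for the polynomial ring, A = R / (C - lambda), d for the degree of
    C, C_a for the partial derivatives, and D_ab f = C_a f_b - C_b f_a.  Up to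
    sign, D_ab f is the bracket of f with n - 1 coordinates, so central elements
    are killed by every D_ab and Poisson ideals are stable under every D_ab.

    The Jacobi identity.  For fixed v, f |-> J(f, v) is a derivation
    sum_j a_j d/dx_j whose coefficients, cofactors of a Jacobian matrix, have
    zero divergence; a derivation of this kind distributes over a Jacobian
    determinant [jac_filippov].

    The centre.  As C is homogeneous, A is graded by Z/d, and every homogeneous
    component of an element of A lifts to a homogeneous polynomial of any
    sufficiently large degree of the right residue; relations between such
    lifts hold already in R [level_graded_inj, level_graded_repr].  If F is a
    homogeneous lift killed by all D_ab, then F and C have proportional
    gradients, by Euler's identity F^d / C^N then has zero gradient, hence
    F^d = a C^N, and closedness of C puts F in K[C], which is K modulo
    C - lambda.  The same argument works with a homogeneous denominator P: if
    s / P is killed by all D_ab then s / P is a scalar [central_fraction]; there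
    one needs that P divides F as soon as P^d divides F^d.

    Simplicity.  Let I be a D_ab-stable ideal, C_j <> 0, and let T be the ring of
    polynomials in the variables other than x_j.  Over Frac T, A becomes a
    finite algebra, without repeated factors because Euler's identity makes the
    level set C = lambda smooth; so I is generated there by an idempotent s / t
    with s in I and t in T [elimination].  The polynomials r that act on I as
    some element of I form a stable ideal; it contains t, and a stable ideal
    containing a nonzero element of T contains a power of C_j
    [stable_ideal_power].  Thus some s' in I acts on I as P = C_j^k.  Then s' / P
    is killed by all D_ab, so it is a scalar: either zero, and I = 0, or nonzero,
    and C_j^k lies in I [partial_power_or_zero].  If I <> 0 the second case holds
    for every j, and Euler's identity sum_j x_j C_j = d C = d lambda gives I = A.
    A factorization of C - lambda would produce idempotents killed by all D_ab,
    which the computation of the constants rules out. *)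

(** * The Jacobi identity for Jacobian brackets *)

Section DetDerivation.
Variables (R : comNzRingType) (m : nat).
Implicit Types (M B : 'M[R]_m) (r : 'I_m -> R).

Definition upd_row M i r : 'M[R]_m :=
  \matrix_(k, l) if k == i then r l else M k l.

Lemma det_upd_row M i r :
  \det (upd_row M i r) = \sum_j r j * cofactor M i j.
Proof.
rewrite (expand_det_row _ i); apply: eq_bigr => j _; rewrite !mxE eqxx.
congr (_ * (_ * \det _)); apply/matrixP => k l; rewrite !mxE.
by rewrite [lift i k == i]eq_sym (negPf (neq_lift _ _)).
Qed.

Lemma det_upd_row_self M i i' : i != i' -> \det (upd_row M i (M i')) = 0.
Proof.
move=> ii'; apply: (determinant_alternate ii') => l.
by rewrite !mxE eqxx eq_sym (negPf ii').
Qed.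

(** The derivative at 0 of det (M (1 + eB)), computed row by row. *)
Lemma det_upd_row_mulmx M B :
  \sum_i \det (upd_row M i ((M *m B) i)) = \tr B * \det M.
Proof.
have -> : \tr B * \det M = \tr (M *m B *m \adj M).
  by rewrite mxtrace_mulC mulmxA mul_adj_mx mul_scalar_mx mxtraceZ mulrC.
rewrite /mxtrace; apply: eq_bigr => i _; rewrite det_upd_row [RHS]mxE.
by apply: eq_bigr => j _; congr (_ * _); rewrite mxE.
Qed.

Lemma det_upd_row2_anti M i i' r r' : i != i' ->
  \det (upd_row (upd_row M i r) i' r') = - \det (upd_row (upd_row M i r') i' r).
Proof.
move=> ii'; rewrite -[in RHS]mulN1r.
have -> : -1 = (-1) ^+ tperm i i' :> R by rewrite odd_tperm ii'.
rewrite -det_perm -det_mulmx -row_permE; congr (\det _).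
apply/matrixP => k l; rewrite !mxE.
case: tpermP => [->|->|/eqP/negPf -> /eqP/negPf ->] //.
  by rewrite !eqxx (negPf ii').
by rewrite !eqxx (negPf ii').
Qed.

Variable D : R -> R.
Hypothesis Dadd : {morph D : x y / x + y}.
Hypothesis Dmul : forall x y, D (x * y) = D x * y + x * D y.

Lemma derivation0 : D 0 = 0.
Proof. by apply: (addrI (D 0)); rewrite -Dadd !addr0. Qed.

Lemma derivationN x : D (- x) = - D x.
Proof. by apply: (addrI (D x)); rewrite -Dadd !subrr derivation0. Qed.

Lemma derivation_sum (I : Type) (s : seq I) (P : pred I) (F : I -> R) :
  D (\sum_(i <- s | P i) F i) = \sum_(i <- s | P i) D (F i).
Proof. exact: (big_morph D Dadd derivation0). Qed.

Lemma derivation_prod k (F : 'I_k -> R) :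
  D (\prod_i F i) = \sum_i \prod_j if j == i then D (F j) else F j.
Proof.
elim: k F => [F|k IH F].
  rewrite !big_ord0; apply: (addrI (D 1)).
  by rewrite addr0 -[in RHS](mulr1 1) Dmul !mulr1 mul1r.
rewrite !big_ord_recl /= Dmul; congr (_ * _ + _).
rewrite IH big_distrr /=; apply: eq_bigr => i _.
by rewrite big_ord_recl.
Qed.

Lemma derivation_det M : D (\det M) = \sum_i \det (upd_row M i (fun l => D (M i l))).
Proof.
rewrite /determinant derivation_sum exchange_big /=; apply: eq_bigr => s _.
have Dsgn (b : bool) x : D ((-1) ^+ b * x) = (-1) ^+ b * D x.
  by case: b; rewrite ?mul1r ?mulN1r ?derivationN.
rewrite Dsgn derivation_prod big_distrr /=; apply: eq_bigr => i _; congr (_ * _).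
by apply: eq_bigr => j _; rewrite mxE; case: eqP => // ->.
Qed.

End DetDerivation.

Section Jacobian.
Variables (m : nat) (K : fieldType).
Local Notation R := {mpoly K[m]}.
Implicit Types (g : 'I_m -> R).

Definition jac_mx g : 'M[R]_m := \matrix_(i, j) (g i)^`M(j).

Definition set_entry g i f : 'I_m -> R := fun k => if k == i then f else g k.

Lemma jac_mx_set_entry g i f :
  jac_mx (set_entry g i f) = upd_row (jac_mx g) i (fun l => f^`M(l)).
Proof. by apply/matrixP => k l; rewrite !mxE /set_entry; case: eqP. Qed.

(** Differentiating the minor a_j by x_j produces the second derivatives
    d_l d_j g_k, symmetric in (j, l), against determinants with jac_rows e_j and e_l,
    antisymmetric in (j, l); the double sum is its own opposite. *)
Lemma cofactor_div_free (char0 : [pchar K] =i pred0) g i :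
  \sum_j (cofactor (jac_mx g) i j)^`M(j) = 0.
Proof.
set M := jac_mx g; pose e (j : 'I_m) (l : 'I_m) : R := (l == j)%:R.
have cofE j : cofactor M i j = \det (upd_row M i (e j)).
  rewrite det_upd_row (bigD1 j) //= /e eqxx mul1r big1 ?addr0 // => l /negPf ->.
  by rewrite mul0r.
pose A k j l := \det (upd_row (upd_row M i (e j)) k (e l)).
have dcofE j : (cofactor M i j)^`M(j) =
    \sum_(k | k != i) \sum_l (g k)^`M(l)^`M(j) * A k j l.
  rewrite cofE (derivation_det (mderivD j) (mderivM j)) (bigD1 i) //=.
  rewrite [X in X + _](_ : _ = 0) ?add0r; last first.
    rewrite det_upd_row big1 // => l _; rewrite mxE eqxx /e.
    by rewrite -mpolyC_nat mderivC mul0r.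
  apply: eq_bigr => k ki; rewrite det_upd_row; apply: eq_bigr => l _.
  rewrite !mxE (negPf ki); congr (_ * _); rewrite /A det_upd_row.
  by rewrite (bigD1 l) //= /e eqxx mul1r big1 ?addr0 // => l' /negPf ->; rewrite mul0r.
rewrite (eq_bigr _ (fun j _ => dcofE j)) exchange_big big1 //= => k ki.
set S := \sum_j _; have : S = - S.
  rewrite {1}/S exchange_big /= -sumrN; apply: eq_bigr => j _.
  rewrite -sumrN; apply: eq_bigr => l _.
  by rewrite mderiv_comm /A det_upd_row2_anti 1?eq_sym // mulrN.
move/eqP; rewrite -subr_eq0 opprK -mulr2n -mulr_natl mulf_eq0 => /orP[|/eqP //].
have := (pcharf0P K).1 char0 2; rewrite -(mpolyC_nat m K) mpolyC_eq0 => ->.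
by [].
Qed.


Lemma eq_jac_mx g g' : g =1 g' -> jac_mx g = jac_mx g'.
Proof. by move=> eg; apply/matrixP => k l; rewrite !mxE eg. Qed.

Lemma det_jac_set_entry g i f :
  \det (jac_mx (set_entry g i f)) = \sum_j f^`M(j) * cofactor (jac_mx g) i j.
Proof. by rewrite jac_mx_set_entry det_upd_row. Qed.

Lemma jac_set_entry_D g i :
  {morph (fun f => \det (jac_mx (set_entry g i f))) : f h / f + h}.
Proof.
move=> f h; rewrite !det_jac_set_entry -big_split; apply: eq_bigr => j _.
by rewrite mderivD mulrDl.
Qed.

Lemma jac_set_entry_M g i f h : \det (jac_mx (set_entry g i (f * h))) =
  \det (jac_mx (set_entry g i f)) * h + f * \det (jac_mx (set_entry g i h)).
Proof.
rewrite !det_jac_set_entry mulr_suml mulr_sumr -big_split; apply: eq_bigr => j _.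
by rewrite mderivM /=; ring.
Qed.

(** With D = sum_j a_j d_j, the commutator of D and d_l has coefficients
    d_l a_j =: B j l, so the two sides differ by tr B * det (jac_mx g), and tr B
    is the divergence of D. *)
Lemma jac_filippov (char0 : [pchar K] =i pred0) w r g :
  \det (jac_mx (set_entry w r (\det (jac_mx g)))) =
  \sum_i \det (jac_mx (set_entry g i (\det (jac_mx (set_entry w r (g i)))))).
Proof.
pose a j := cofactor (jac_mx w) r j.
pose D f := \det (jac_mx (set_entry w r f)).
have DE f : D f = \sum_j f^`M(j) * a j by exact: det_jac_set_entry.
pose B : 'M[R]_m := \matrix_(j, l) (a j)^`M(l).
have trB : \tr B = 0.
  rewrite -[RHS](cofactor_div_free char0 w r).
  by apply: eq_bigr => j _; rewrite mxE.
have eD i l : (D (g i))^`M(l) = D (jac_mx g i l) + (jac_mx g *m B) i l.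
  rewrite !DE (derivation_sum (mderivD l)) !mxE -big_split; apply: eq_bigr => j _.
  by rewrite !mxE mderivM mderiv_comm.
rewrite -/(D _).
have -> := derivation_det (jac_set_entry_D w r : {morph D : x y / x + y})
  (jac_set_entry_M w r) (jac_mx g).
set S := LHS; have -> : S = S + \tr B * \det (jac_mx g).
  by rewrite trB mul0r addr0.
rewrite -det_upd_row_mulmx {}/S.
rewrite -big_split; apply: eq_bigr => i _ /=.
rewrite jac_mx_set_entry !det_upd_row -big_split; apply: eq_bigr => l _ /=.
by rewrite -/(D _) eD mulrDl.
Qed.

End Jacobian.

Section PBracket.
Variables (n : nat) (K : fieldType) (C : {mpoly K[n.+1]}).
Local Notation R := {mpoly K[n.+1]}.
Implicit Types (u v : {ffun 'I_n -> R}).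

Definition jac_rows u : 'I_n.+1 -> R := fun i => oapp u C (unlift ord_max i).

Lemma jac_rows_setarg u i f :
  jac_rows (setarg u i f) =1 set_entry (jac_rows u) (lift ord_max i) f.
Proof.
move=> k; rewrite /jac_rows /set_entry; case: (unliftP ord_max k) => [j|] -> /=.
  by rewrite ffunE (inj_eq (@lift_inj _ _)).
by rewrite (negPf (neq_lift _ _)).
Qed.

Lemma P_bracket_setarg u i f :
  P_bracket C (setarg u i f) =
  \det (jac_mx (set_entry (jac_rows u) (lift ord_max i) f)).
Proof. by rewrite -(eq_jac_mx (jac_rows_setarg u i f)). Qed.

Lemma P_bracket_linear u i (a : K) (f h : R) :
  P_bracket C (setarg u i (a *: f + h)) =
  a *: P_bracket C (setarg u i f) + P_bracket C (setarg u i h).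
Proof.
rewrite !P_bracket_setarg jac_set_entry_D; congr (_ + _).
rewrite !det_jac_set_entry scaler_sumr; apply: eq_bigr => j _.
by rewrite mderivZ scalerAl.
Qed.

Lemma P_bracket_leibniz u i (f h : R) :
  P_bracket C (setarg u i (f * h)) =
  f * P_bracket C (setarg u i h) + P_bracket C (setarg u i f) * h.
Proof. by rewrite !P_bracket_setarg jac_set_entry_M addrC. Qed.

Lemma P_bracket_skew u (s : 'S_n) :
  P_bracket C [ffun i => u (s i)] = (-1) ^+ s * P_bracket C u.
Proof.
have -> : odd_perm s = lift_perm ord_max ord_max s.
  by rewrite odd_lift_perm addbb.
rewrite -det_perm -det_mulmx.
rewrite -row_permE; congr (\det _); apply/matrixP => k l; rewrite !mxE.
by case: (unliftP ord_max k) => [j|] ->;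
  rewrite ?lift_perm_lift ?lift_perm_id ?liftK ?unlift_none /= ?ffunE.
Qed.

(** The identity for the full Jacobian, with C as last argument; the term in
    which the derivation falls on that argument has the row of C twice. *)
Lemma P_bracket_jacobi (char0 : [pchar K] =i pred0) u v i0 :
  P_bracket C (setarg v i0 (P_bracket C u)) =
  \sum_i P_bracket C (setarg u i (P_bracket C (setarg v i0 (u i)))).
Proof.
rewrite P_bracket_setarg [P_bracket C u](_ : _ = \det (jac_mx (jac_rows u))) //.
rewrite (jac_filippov char0) (bigD1_ord ord_max) //=.
rewrite [X in X + _](_ : _ = 0) ?add0r.
  apply: eq_bigr => i _; rewrite !P_bracket_setarg.
  by have -> : jac_rows u (lift ord_max i) = u i by rewrite /jac_rows liftK.
rewrite [X in set_entry _ _ X](_ : _ = 0).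
  by rewrite det_jac_set_entry big1 // => j _; rewrite mderiv0 mul0r.
have ne : lift ord_max i0 != ord_max by rewrite eq_sym neq_lift.
rewrite jac_mx_set_entry -[RHS](det_upd_row_self (jac_mx (jac_rows v)) ne).
congr (\det _); apply/matrixP => k l; rewrite !mxE.
by rewrite /jac_rows unlift_none.
Qed.

End PBracket.

(** * Passing to the quotient *)

Section Descent.
Variables (n : nat) (K : fieldType) (C : {mpoly K[n.+1]}) (lambda : K).
Variable hC : nonconstant C.
Local Notation R := {mpoly K[n.+1]}.
Local Notation A := (level_quot lambda hC).
Local Notation pi := (level_proj lambda hC).

Definition pi_ffun (f : {ffun 'I_n -> R}) : {ffun 'I_n -> A} :=
  [ffun i => pi (f i)].

Lemma pi_surj (x : A) : exists f, x = pi f.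
Proof. by exists (repr x); rewrite /level_proj (reprK (x : {ideal_quot _})). Qed.

Lemma pi_ffun_surj (u : {ffun 'I_n -> A}) : exists f, u = pi_ffun f.
Proof.
have /fin_all_exists[f hf] i := pi_surj (u i).
by exists [ffun i => f i]; apply/ffunP => i; rewrite !ffunE.
Qed.

Lemma setarg_pi_ffun f i x : setarg (pi_ffun f) i (pi x) = pi_ffun (setarg f i x).
Proof. by apply/ffunP => j; rewrite !ffunE; case: eqP. Qed.

Lemma S_bracket_pi f : S_bracket (pi_ffun f) = pi (P_bracket C f).
Proof. exact: S_bracketE. Qed.

Lemma pi_scale a f : pi (a *: f) = a *: pi f.
Proof. by rewrite -mul_mpolyC rmorphM. Qed.

Lemma S_bracket_nLiePoisson (char0 : [pchar K] =i pred0) :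
  is_nLiePoisson (@S_bracket n K C lambda hC).
Proof.
split.
- move=> u i a x y; have [f ->] := pi_ffun_surj u.
  have [{}x ->] := pi_surj x; have [{}y ->] := pi_surj y.
  rewrite -pi_scale -rmorphD !setarg_pi_ffun !S_bracket_pi -pi_scale -rmorphD.
  by rewrite P_bracket_linear.
- move=> u s; have [f ->] := pi_ffun_surj u.
  have -> : [ffun i => pi_ffun f (s i)] = pi_ffun [ffun i => f (s i)].
    by apply/ffunP => j; rewrite !ffunE.
  by rewrite !S_bracket_pi P_bracket_skew rmorphM rmorph_sign.
- move=> u i x y; have [f ->] := pi_ffun_surj u.
  have [{}x ->] := pi_surj x; have [{}y ->] := pi_surj y.
  rewrite -rmorphM !setarg_pi_ffun !S_bracket_pi -!rmorphM -rmorphD.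
  by rewrite P_bracket_leibniz.
- move=> u v i0 _; have [f ->] := pi_ffun_surj u; have [g ->] := pi_ffun_surj v.
  rewrite S_bracket_pi setarg_pi_ffun S_bracket_pi P_bracket_jacobi // rmorph_sum.
  apply: eq_bigr => i _; rewrite [pi_ffun f i]ffunE (setarg_pi_ffun g).
  by rewrite S_bracket_pi setarg_pi_ffun S_bracket_pi.
Qed.

End Descent.

(** * Hamiltonian derivations *)

Lemma det_identity_rows (R : comNzRingType) p (M : 'M[R]_p.+2) :
  (forall i j : 'I_p.+2, (i < p)%N -> M i j = (i == j)%:R) ->
  let x : 'I_p.+2 := lift ord_max ord_max in
  \det M = M x x * M ord_max ord_max - M x ord_max * M ord_max x.
Proof.
elim: p M => [|p IH] M hM /=.
  rewrite (expand_det_row _ ord0) !big_ord_recl big_ord0 /cofactor !det_mx11.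
  rewrite !mxE /= expr0 expr1 addr0 mul1r mulN1r mulrN.
  by congr (M _ _ * M _ _ - M _ _ * M _ _); apply: val_inj.
rewrite (expand_det_row _ ord0) (bigD1 ord0) //= hM // eqxx mul1r.
rewrite [X in _ + X]big1 ?addr0; last first.
  by move=> j; rewrite eq_sym hM // => /negPf ->; rewrite mul0r.
rewrite /cofactor addn0 expr0 mul1r IH; last first.
  by move=> i j ip; rewrite !mxE hM ?(inj_eq (@lift_inj _ _)).
rewrite !mxE.
have -> : lift ord0 (lift ord_max ord_max) = lift ord_max ord_max :> 'I_p.+3.
  by apply: val_inj; rewrite /= /bump /= !ltnn.
by have -> : lift ord0 ord_max = ord_max :> 'I_p.+3 by apply: val_inj.
Qed.

Lemma perm_two_points (T : finType) (x y a b : T) : x != y -> a != b ->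
  exists s : {perm T}, s x = a /\ s y = b.
Proof.
move=> xy ab; exists (tperm x a * tperm (tperm x a y) b)%g.
rewrite !permM tpermL tpermL; split=> //; apply: tpermD; last by rewrite eq_sym.
by rewrite -{2}(tpermL x a) (inj_eq perm_inj) eq_sym.
Qed.

Lemma mderivXU m (K : fieldType) (i j : 'I_m) :
  ('X_i)^`M(j) = (i == j)%:R :> {mpoly K[m]}.
Proof.
rewrite mderivX mnm1E; case: eqP => [->|_]; last by rewrite scale0r.
suff -> : (U_(j) - U_(j) = 0 :> 'X_{1..m})%MM by rewrite mpolyX0 scale1r.
by apply/mnmP => k; rewrite !mnmE subnn.
Qed.

Section Hamiltonian.
Variables (m : nat) (K : fieldType).
Local Notation R := {mpoly K[m]}.
Implicit Types (C f g : R).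

(** The 2 x 2 minors of the Jacobian matrix of (C, f). *)
Definition ham C a b f : R := C^`M(a) * f^`M(b) - C^`M(b) * f^`M(a).

Lemma hamD C a b : {morph ham C a b : f g / f + g}.
Proof. by move=> f g; rewrite /ham !mderivD; ring. Qed.

Lemma hamM C a b f g : ham C a b (f * g) = ham C a b f * g + f * ham C a b g.
Proof. by rewrite /ham !mderivM; ring. Qed.

Lemma ham_self C a b : ham C a b C = 0.
Proof. by rewrite /ham; ring. Qed.

Lemma hamC C a b c : ham C a b c%:MP = 0.
Proof. by rewrite /ham !mderivC !mulr0 subr0. Qed.

Lemma hamB C a b : {morph ham C a b : f g / f - g}.
Proof. by move=> f g; rewrite /ham !mderivB; ring. Qed.

End Hamiltonian.

(** The other arguments are the coordinates x_(s i), for a permutation s sending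
    the last two places to b and a: permuting the columns by s puts the Jacobian
    matrix in the form of the lemma on identity jac_rows. *)
Lemma P_bracket_ham (p : nat) (K : fieldType) (C : {mpoly K[p.+2]})
    (a b : 'I_p.+2) : a != b ->
  exists (u : {ffun 'I_p.+1 -> {mpoly K[p.+2]}}) (e : bool),
    forall f, P_bracket C (setarg u ord_max f) = (-1) ^+ e * ham C a b f.
Proof.
move=> ab; pose x : 'I_p.+2 := lift ord_max ord_max.
have [s [sx sy]] : exists s : 'S_p.+2, s ord_max = a /\ s x = b.
  by apply: perm_two_points; rewrite // neq_lift.
exists [ffun i => 'X_(s (lift ord_max i))], s => f.
set u := finfun _; set M := jac_mx (jac_rows C (setarg u ord_max f)).
have detM : \det (col_perm s M) = ham C a b f.
  have Mx k : M x k = f^`M(k) by rewrite mxE /jac_rows liftK /= !ffunE eqxx.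
  have My k : M ord_max k = C^`M(k) by rewrite mxE /jac_rows unlift_none.
  rewrite det_identity_rows; last first.
    move=> i j ip; rewrite !mxE /jac_rows.
    case: (unliftP ord_max i) ip => [k|] -> ip; last by rewrite ltnNge leqnSn in ip.
    rewrite lift_max in ip; rewrite /= !ffunE.
    have /negPf -> : k != ord_max by apply: contraTneq ip => ->; rewrite /= ltnn.
    by rewrite mderivXU (inj_eq perm_inj).
  have cE i j : col_perm s M i j = M i (s j) by rewrite mxE.
  by rewrite -/x !cE !Mx !My sx sy /ham; ring.
rewrite -detM col_permE det_mulmx det_perm mulrC.
by rewrite -mulrA -signr_addb odd_permV addbb mulr1.
Qed.

(** * Homogeneous polynomials on a level set *)

Section Homogeneous.
Variables (m : nat) (K : fieldType).
Local Notation R := {mpoly K[m]}.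
Implicit Types (f g P : R).

Lemma pihomog_size N f : pihomog mdeg N f != 0 -> (N < msize f)%N.
Proof.
apply: contraNT; rewrite -leqNgt => le; rewrite pihomogE big_seq_cond big_pred0 // => k.
apply/andP => -[/msize_mdeg_lt kf /eqP kN]; rewrite kN ltnNge le in kf.
by [].
Qed.

Lemma pihomog_sum_bound k f : (msize f <= k)%N -> f = \sum_(N < k) pihomog mdeg N f.
Proof. exact: pihomog_partitionE. Qed.

Lemma pihomogM p P g N : P \is p.-homog ->
  pihomog mdeg (p + N) (P * g) = P * pihomog mdeg N g.
Proof.
move=> hP; pose k := maxn (msize g) N.+1.
rewrite {1}(@pihomog_sum_bound k g) ?leq_maxl // mulr_sumr linear_sum /=.
have Nk : (N < k)%N by rewrite /k leq_max leqnn orbT.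
rewrite (bigD1 (Ordinal Nk)) //= [X in _ + X]big1 ?addr0.
  by rewrite pihomog_dE //; apply: dhomogM hP (pihomogP _ _ _).
move=> i iN; apply: (@pihomog_ne0 _ _ _ (p + i)); last first.
  exact: dhomogM hP (pihomogP _ _ _).
by rewrite eqn_add2l; apply: contra iN => /eqP e; apply/eqP/val_inj.
Qed.

Lemma pihomogM_lt p P g N : P \is p.-homog -> (N < p)%N ->
  pihomog mdeg N (P * g) = 0.
Proof.
move=> hP Np; rewrite (@pihomog_sum_bound _ g (leqnn _)) mulr_sumr linear_sum /=.
rewrite big1 // => i _; apply: (@pihomog_ne0 _ _ _ (p + i)); last first.
  exact: dhomogM hP (pihomogP _ _ _).
by rewrite eq_sym neq_ltn (leq_trans Np) ?leq_addr.
Qed.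

Lemma dhomog_mderiv N f i : f \is N.+1.-homog -> f^`M(i) \is N.-homog.
Proof.
move=> hf; apply/dhomogP => k; rewrite mcoeff_msupp mcoeff_mderiv => nz.
have : f@_(k + U_(i)) != 0 by apply: contraNneq nz => ->; rewrite mul0rn.
rewrite -mcoeff_msupp => /(dhomog_mf hf); rewrite /= mdegD mdeg1 addn1.
by case.
Qed.

Lemma euler N f : f \is N.-homog -> \sum_i 'X_i * f^`M(i) = N%:R *: f.
Proof.
move=> /dhomogP hf.
under eq_bigr => i _ do rewrite {1}[f]mpolyE (derivation_sum (mderivD i)) mulr_sumr.
rewrite exchange_big /= [in RHS](mpolyE f) scaler_sumr big_seq [RHS]big_seq.
apply: eq_bigr => k /hf /= <-.
rewrite mdegE natr_sum scaler_suml; apply: eq_bigr => i _.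
rewrite mderivZ mderivX scalerA -scalerAr scalerA.
case: (posnP (k i)) => [->|ki]; first by rewrite mulr0 mul0r !scale0r.
rewrite -mpolyXD addmC submK ?lep1mP -?lt0n //.
by rewrite mulrC.
Qed.

End Homogeneous.

Section Level.
Variables (m : nat) (K : fieldType) (C : {mpoly K[m]}) (lambda : K).
Variables (d : nat) (hC : nonconstant C).
Hypotheses (hom : C \is d.+1.-homog) (lambda0 : lambda != 0).
Local Notation R := {mpoly K[m]}.
Local Notation pi := (level_proj lambda hC).
Implicit Types (f g P : R).

Lemma pi_eq0P f : pi f = 0 <-> exists u, f = (C - lambda%:MP) * u.
Proof.
rewrite -(rmorph0 pi); split=> [/eqP|[u ->]]; last apply/eqP.
  by rewrite level_proj_eq subr0 => /asboolP[u ->]; exists u; rewrite mulrC.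
by rewrite level_proj_eq subr0; apply/asboolP; exists u; rewrite mulrC.
Qed.

Lemma pi_C : pi C = pi lambda%:MP.
Proof.
apply/eqP; rewrite -subr_eq0 -rmorphB; apply/eqP/pi_eq0P.
by exists 1; rewrite mulr1.
Qed.

Lemma C_neq0 : C != 0.
Proof. by rewrite -(mpolyC0 m K). Qed.

(** A multiple (C - lambda) u with u <> 0 spreads over more than a window of
    degrees [M, M + d): its lowest component is -lambda times the lowest component
    of u, and its highest one is C times the highest component of u.  (The degree
    of C is written d.+1, so the window has d.+1 elements.) *)
Lemma level_graded_inj M (F : nat -> R) :
  (forall k, F k \is (M + k).-homog) -> pi (\sum_(k < d.+1) F k) = 0 ->
  forall k, (k < d.+1)%N -> F k = 0.
Proof.
move=> hF /pi_eq0P[u eu].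
pose c N := pihomog mdeg N (\sum_(k < d.+1) F k).
have c0 N : (N < M)%N || (M + d.+1 <= N)%N -> c N = 0.
  move=> NM; rewrite /c linear_sum big1 //= => k _.
  apply: pihomog_ne0 (hF k); apply: contraTneq NM => <-.
  by rewrite negb_or -leqNgt leq_addr leq_add2l -leqNgt -ltnS ltn_ord.
have cE N : c N = pihomog mdeg N (C * u) - lambda *: pihomog mdeg N u.
  by rewrite /c eu mulrBl mul_mpolyC linearB linearZ.
suff u0 : u = 0.
  move=> k kd; rewrite -(pihomog_dE (hF k)).
  transitivity (c (M + k)); last by rewrite /c eu u0 mulr0 linear0.
  rewrite /c linear_sum (bigD1 (Ordinal kd)) //= big1 ?addr0 // => i ik.
  apply: pihomog_ne0 (hF i); rewrite eqn_add2l.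
  by apply: contra ik => /eqP e; apply/eqP/val_inj.
apply/eqP/negPn/negP => unz.
have ex : exists N, pihomog mdeg N u != 0.
  apply: contrapT => /forallNP all0; case/negP: unz; apply/eqP.
  rewrite (@pihomog_sum_bound _ _ _ u (leqnn _)) big1 // => i _.
  by apply/eqP/negPn/negP/all0.
have [lo lo_nz lo_min] := ex_minnP ex.
have ub N : pihomog mdeg N u != 0 -> (N <= msize u)%N.
  by move/pihomog_size/ltnW.
have [hi hi_nz hi_max] := ex_maxnP ex ub.
have [loM|Mlo] := ltnP lo M.
  have := cE lo; rewrite c0 ?loM // => /eqP.
  rewrite (_ : pihomog mdeg lo (C * u) = 0) ?sub0r.
    by rewrite eq_sym oppr_eq0 scaler_eq0 (negPf lambda0) (negPf lo_nz).
  have [lod|dlo] := ltnP lo d.+1; first exact: pihomogM_lt hom lod.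
  rewrite -(subnKC dlo) (pihomogM _ _ hom).
  have [->|/lo_min] := eqVneq (pihomog mdeg (lo - d.+1) u) 0; first by rewrite mulr0.
  by rewrite leqNgt ltn_subrL (leq_trans _ dlo).
have := cE (d.+1 + hi)%N; rewrite c0; last first.
  by rewrite addnC leq_add2r (leq_trans Mlo) ?orbT // hi_max.
rewrite (pihomogM _ _ hom) (_ : pihomog mdeg (d.+1 + hi) u = 0).
  rewrite scaler0 subr0 => /eqP.
  by rewrite eq_sym mulf_eq0 (negPf C_neq0) (negPf hi_nz).
by apply/eqP/negPn/negP => /hi_max; rewrite addSn ltnNge leq_addl.
Qed.

(** Modulo C - lambda, multiplication by C / lambda is the identity, and it
    raises degrees by d.+1. *)
Lemma level_graded_repr f M : (msize f <= M)%N ->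
  exists F : nat -> R, (forall k, F k \is (M + k).-homog) /\
    pi f = pi (\sum_(k < d.+1) F k).
Proof.
move=> fM; rewrite {1}(@pihomog_sum_bound _ _ _ f (leqnn _)).
apply: (big_ind (fun f => exists F : nat -> R, (forall k, F k \is (M + k).-homog) /\
    pi f = pi (\sum_(k < d.+1) F k))).
- by exists (fun=> 0); split=> [k|]; rewrite ?dhomog0 // big1.
- move=> g h [F [hF eF]] [G [hG eG]]; exists (fun k => F k + G k).
  by split=> [k|]; [apply: dhomogD|rewrite big_split !rmorphD /= eF eG].
- move=> N _; set g := pihomog _ _ _; pose e := ((M - N + d) %/ d.+1)%N.
  have NM : (N < M)%N by apply: leq_trans (ltn_ord N) fM.
  have eE := divn_eq (M - N + d) d.+1; rewrite -/e in eE.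
  have rlt := ltn_pmod (M - N + d) (ltn0Sn d).
  pose k0 := (d - (M - N + d) %% d.+1)%N.
  have k0d : (k0 < d.+1)%N by rewrite /k0; lia.
  have k0E : (M + k0 = d.+1 * e + N)%N by rewrite /k0 mulnC; lia.
  (* e factors C / lambda move degree N to the degree M + k0 of the window *)
  exists (fun k => if k == k0 then (lambda^-1 ^+ e) *: (C ^+ e * g) else 0).
  split=> [k|].
    case: eqP => [->|_]; last exact: dhomog0.
    rewrite k0E; apply/dhomogZ/dhomogM; last exact: pihomogP.
    exact: dhomogMn.
  rewrite (bigD1 (Ordinal k0d)) //= eqxx big1 ?addr0; last first.
    by move=> i; rewrite -val_eqE /= => /negPf ->.
  rewrite -mul_mpolyC !rmorphM !rmorphXn /= pi_C mulrA -exprMn -rmorphM.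
  by rewrite -mpolyCM mulVf // rmorph1 expr1n mul1r.
Qed.

(** A homogeneous P preserves windows of degrees, so P f = 0 in the quotient
    is a relation between homogeneous lifts, which holds in the polynomial ring. *)
Lemma pi_homog_reg p P f : P \is p.-homog -> P != 0 -> pi (P * f) = 0 -> pi f = 0.
Proof.
move=> hP P0; have [F [hF eF]] := level_graded_repr (leqnn (msize f)).
rewrite rmorphM /= eF -rmorphM mulr_sumr => PF0.
have hPF k : P * F k \is (p + msize f + k).-homog.
  by rewrite -addnA; apply: dhomogM.
rewrite big1 ?rmorph0 // => k _.
have /eqP := level_graded_inj hPF PF0 (ltn_ord k).
by rewrite mulf_eq0 (negPf P0) => /eqP.
Qed.

End Level.

(** * Proportionality and divisibility through leading monomials *)

Section MonomialOrder.
Variables (m : nat) (K : fieldType).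
Local Notation R := {mpoly K[m]}.
Implicit Types (f g P Q F G H : R).

Lemma mcoeff_euler i f k : ('X_i * f^`M(i))@_k = (k i)%:R * f@_k.
Proof.
rewrite [in LHS](mpolyE f) [in RHS](mpolyE f) (derivation_sum (mderivD i)) mulr_sumr.
rewrite !raddf_sum mulr_sumr; apply: eq_bigr => l _ /=.
rewrite mderivZ mderivX scalerA -scalerAr !mcoeffZ.
have [li|li] := posnP (l i).
  rewrite li mulr0 mul0r mcoeffX; case: eqP => [<-|_]; first by rewrite li mul0r.
  by rewrite !mulr0.
rewrite -mpolyXD addmC submK ?lep1mP -?lt0n // mcoeffX.
by case: eqP => [->|_]; rewrite ?mulr0 //; ring.
Qed.

Lemma mlead_euler i f : (mlead ('X_i * f^`M(i)) <= mlead f)%O.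
Proof.
have [->|nz] := eqVneq ('X_i * f^`M(i)) 0; first by rewrite mlead0 le0x.
apply: msupp_le_mlead; have := mlead_supp nz.
by rewrite !mcoeff_msupp mcoeff_euler; apply: contraNneq => ->; rewrite mulr0.
Qed.

(** Subtract from G the multiple of H that kills the coefficient at the leading
    monomial of H.  If G' is the difference and G' <> 0, the coefficient of
    H (x_i d_i G') - G' (x_i d_i H) at the product of the leading monomials is the
    product of the leading coefficients times the difference of the exponents
    of x_i, so the two leading monomials agree: a contradiction. *)
Lemma wronskian_proportional (char0 : [pchar K] =i pred0) G H : H != 0 ->
  (forall i, H * G^`M(i) = G * H^`M(i)) -> exists a, G = a *: H.
Proof.
move=> H0 HG; pose a := G@_(mlead H) / mleadc H; exists a.
apply/eqP; rewrite -subr_eq0; apply/negPn/negP; set G' := G - a *: H => G'0.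
have lH0 : mleadc H != 0 by rewrite mleadc_eq0.
have lG'0 : mleadc G' != 0 by rewrite mleadc_eq0.
have G'H : G'@_(mlead H) = 0 by rewrite mcoeffB mcoeffZ divfK ?subrr.
case/negP: lG'0; suff -> : mlead G' = mlead H by rewrite G'H.
apply/mnmP => i.
have HG' : H * ('X_i * G'^`M(i)) = G' * ('X_i * H^`M(i)).
  rewrite /G' mderivB mderivZ -!mul_mpolyC.
  transitivity ('X_i * (H * G^`M(i)) - a%:MP * 'X_i * H * H^`M(i)); first by ring.
  by rewrite HG; ring.
have /(congr1 (mcoeff (mlead H + mlead G')%MM)) := HG'.
rewrite mleadcMW ?mlead_euler // addmC mleadcMW ?mlead_euler // !mcoeff_euler.
move/eqP; rewrite -subr_eq0.
have -> : mleadc H * ((mlead G' i)%:R * mleadc G') -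
    mleadc G' * ((mlead H i)%:R * mleadc H)
  = mleadc G' * mleadc H * ((mlead G' i)%:R - (mlead H i)%:R) by ring.
rewrite !mulf_eq0 mleadc_eq0 (negPf G'0) (negPf lH0) /= subr_eq0.
have char0' := (pcharf0P K).1 char0.
case: (ltngtP (mlead G' i) (mlead H i)) => // lt; last rewrite eq_sym.
  rewrite -(subnK (ltnW lt)) natrD -subr_eq0 opprD addrCA subrr addr0 oppr_eq0 char0'.
  by rewrite subn_eq0 leqNgt lt.
rewrite -(subnK (ltnW lt)) natrD -subr_eq0 opprD addrCA subrr addr0 oppr_eq0 char0'.
by rewrite subn_eq0 leqNgt lt.
Qed.

(** Comparing leading monomials for large k, the leading monomial of Q divides
    that of F.  Cancelling it subtracts a multiple w Q from F, which preserves the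
    hypothesis by the binomial formula and lowers the leading monomial. *)
Lemma completely_integrally_closed P Q F : P != 0 -> Q != 0 ->
  (forall k, exists S, P * F ^+ k = S * Q ^+ k) -> exists phi, F = Q * phi.
Proof.
move=> P0 Q0; elim/mleadrect: F => F IH hF.
have [->|F0] := eqVneq F 0; first by exists 0; rewrite mulr0.
have QF : (mlead Q <= mlead F)%MM.
  apply/mnm_lepP => i; rewrite leqNgt; apply/negP => lt.
  (* this exponent exceeds the degree of the leading monomial of P in x_i *)
  have [S eS] := hF (mlead P i).+1.
  have S0 : S != 0.
    apply: contraTneq (mulf_neq0 P0 (expf_neq0 (mlead P i).+1 F0)) => S0.
    by rewrite eS S0 mul0r eqxx.
  have := congr1 (fun f => mlead f i) eS.
  rewrite /= !mleadM ?expf_neq0 // !mleadX // !mnmDE !mulmnE.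
  have := leq_mul lt (leqnn (mlead P i).+1).
  move: (mlead P i) (mlead F i) (mlead Q i) (mlead S i) => p f q s.
  by rewrite mulSn; lia.
pose w := (mleadc F / mleadc Q) *: 'X_[mlead F - mlead Q].
have lwQ : mlead (w * Q) = mlead F.
  rewrite mleadM // ?mleadZ ?mleadXm ?submK //.
    by rewrite mulf_neq0 ?invr_eq0 ?mleadc_eq0.
  rewrite -mleadc_eq0 /w mleadZ ?mleadXm ?mcoeffZ ?mcoeffX ?eqxx ?mulr1;
    by rewrite mulf_neq0 ?invr_eq0 ?mleadc_eq0.
have cF' : (F - w * Q)@_(mlead F) = 0.
  rewrite mcoeffB -{2}(submK QF) mleadcMW ?mcoeffZ ?mcoeffX ?eqxx ?mulr1 //.
    by rewrite divfK ?subrr // mleadc_eq0.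
  by apply: le_trans (mleadZ_le _ _) _; rewrite mleadXm.
have [F'0|F'0] := eqVneq (F - w * Q) 0.
  by exists w; apply/eqP; rewrite -subr_eq0 mulrC F'0.
have [phi ephi] : exists phi, F - w * Q = Q * phi.
  apply: IH.
    have := mleadB_le F (w * Q); rewrite lwQ joinxx.
    rewrite le_eqVlt => /predU1P[e|//].
    by move: F'0; rewrite -mleadc_eq0 e cF' eqxx.
  move=> k; rewrite exprBn mulr_sumr.
  apply: (big_ind (fun f => exists S, f = S * Q ^+ k)).
  - by exists 0; rewrite mul0r.
  - by move=> f g [S ->] [T ->]; exists (S + T); rewrite mulrDl.
  - move=> i _; have [S eS] := hF (k - i)%N.
    exists ((-1) ^+ i * S * w ^+ i *+ 'C(k, i)).
    rewrite mulrnAr mulrnAl; congr (_ *+ _).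
    have -> : Q ^+ k = Q ^+ (k - i) * Q ^+ i by rewrite -exprD subnK // -ltnS.
    rewrite exprMn; transitivity ((-1) ^+ i * w ^+ i * Q ^+ i * (P * F ^+ (k - i))).
      by ring.
    by rewrite eS; ring.
exists (phi + w); rewrite mulrDr -ephi; by ring.
Qed.

Lemma dvd_of_dvd_exp d Q F T : Q != 0 ->
  F ^+ d.+1 = Q ^+ d.+1 * T -> exists phi, F = Q * phi.
Proof.
move=> Q0 e; apply: (@completely_integrally_closed (Q ^+ d.+1) Q) => //.
  exact: expf_neq0.
move=> k; rewrite {1}(divn_eq k d.+1).
set q := (k %/ _)%N; set r := (k %% _)%N.
have rd : (r < d.+1)%N by exact: ltn_pmod.
exists (F ^+ r * T ^+ q * Q ^+ (d.+1 - r)).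
have -> : Q ^+ k = Q ^+ (d.+1 * q) * Q ^+ r by rewrite -exprD mulnC -divn_eq.
rewrite -{1}(subnK (ltnW rd)) exprD exprD mulnC exprM e exprMn -exprM; ring.
Qed.

End MonomialOrder.

(** * Central fractions *)

Section CentralFraction.
Variables (m : nat) (K : fieldType) (C : {mpoly K[m]}) (lambda : K).
Variables (d : nat) (hC : nonconstant C).
Hypotheses (hom : C \is d.+1.-homog) (lambda0 : lambda != 0).
Hypotheses (char0 : [pchar K] =i pred0) (hclosed : closed_mpoly C).
Local Notation R := {mpoly K[m]}.
Local Notation pi := (level_proj lambda hC).
Implicit Types (f g P F : R).

Lemma pi_ham a b f g : pi f = pi g -> pi (ham C a b f) = pi (ham C a b g).
Proof.
move/eqP; rewrite -subr_eq0 -rmorphB => /eqP/pi_eq0P[u e].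
apply/eqP; rewrite -subr_eq0 -rmorphB -hamB e; apply/eqP/pi_eq0P.
exists (ham C a b u).
by rewrite hamM hamB ham_self hamC subr0 mul0r add0r.
Qed.

Lemma ham_dhomog p a b f : f \is p.+1.-homog -> ham C a b f \is (d + p).-homog.
Proof.
by move=> hf; apply: rpredB; apply: dhomogM; apply: dhomog_mderiv.
Qed.

Lemma ham_dhomog0 a b f : f \is 0.-homog -> ham C a b f = 0.
Proof.
move=> hf; have df i : f^`M(i) = 0.
  apply/mpolyP => k; rewrite mcoeff_mderiv mcoeff0.
  by rewrite (dhomog_nemf_coeff hf) ?mul0rn //= mdegD mdeg1 addn1.
by rewrite /ham !df !mulr0 subr0.
Qed.

Lemma euler_ham p b f : f \is p.-homog ->
  \sum_a 'X_a * ham C a b f = d.+1%:R * C * f^`M(b) - p%:R * f * C^`M(b).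
Proof.
move=> hf.
transitivity ((\sum_a 'X_a * C^`M(a)) * f^`M(b) - C^`M(b) * \sum_a 'X_a * f^`M(a)).
  rewrite mulr_suml mulr_sumr -sumrB; apply: eq_bigr => a _.
  by rewrite /ham; ring.
rewrite (euler hom) (euler hf) -!mul_mpolyC !mpolyC_nat; ring.
Qed.

Lemma pi_horner_alg q : pi (horner_alg C q) = pi (q.[lambda])%:MP.
Proof.
elim/poly_ind: q => [|q c IH]; first by rewrite !(rmorph0, horner0).
rewrite rmorphD !rmorphM /= horner_algX horner_algC.
rewrite !rmorphD !rmorphM /= IH (pi_C lambda hC) hornerMXaddC mpolyCD mpolyCM.
by rewrite rmorphD rmorphM; congr (_ + pi _); rewrite -mul_mpolyC mulr1.
Qed.

(** F is a root of X^d - a C^N, hence integral over K[C]; closedness makes F a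
    polynomial in C, and C is the scalar lambda in the quotient. *)
Lemma closed_root F N a : F ^+ d.+1 = a *: C ^+ N ->
  exists c : K, pi F = pi c%:MP.
Proof.
move=> e; have [|q ->] := hclosed (f := F); last by eexists; exact: pi_horner_alg.
exists ('X^(d.+1) - (a *: 'X^N)%:P); first exact: monicXnsubC.
rewrite rmorphB /= map_polyXn map_polyC /= /root !hornerE ?hornerXn e.
by rewrite linearZ /= rmorphXn /= horner_algX mulr_algl subrr.
Qed.

(** Contracting the hypothesis with the Euler field shows that F^d and C^N P^d
    have proportional gradients, where d is the degree of C (d.+1 below).  So they
    are proportional, P divides F, and the d-th power of the quotient is a scalar
    multiple of C^N. *)
Lemma homog_central_fraction p N P F :
  P \is p.-homog -> P != 0 -> F \is (N + p).-homog ->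
  (forall a b, P * ham C a b F = F * ham C a b P) ->
  exists c : K, pi F = pi (c%:MP * P).
Proof.
move=> hP P0 hF PF.
have C0 : C != 0 := C_neq0 hC.
have key b : d.+1%:R * C * (P * F^`M(b) - F * P^`M(b)) = N%:R * F * P * C^`M(b).
  have : P * \sum_a 'X_a * ham C a b F = F * \sum_a 'X_a * ham C a b P.
    rewrite !mulr_sumr; apply: eq_bigr => a _.
    by rewrite mulrCA PF mulrCA.
  rewrite (euler_ham b hF) (euler_ham b hP) natrD => e.
  apply/eqP; rewrite -subr_eq0; apply/eqP.
  transitivity (P * (d.+1%:R * C * F^`M(b) - (N%:R + p%:R) * F * C^`M(b)) -
     F * (d.+1%:R * C * P^`M(b) - p%:R * P * C^`M(b))); first by ring.
  by rewrite e subrr.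
have derX k f b : (f ^+ k.+1)^`M(b) = k.+1%:R * f ^+ k * f^`M(b).
  elim: k => [|k IH]; first by rewrite expr0 !expr1; ring.
  by rewrite exprS mderivM IH exprS -(natr1 k.+1); ring.
have derCN b : C * (C ^+ N)^`M(b) = N%:R * C ^+ N * C^`M(b).
  case: (N) => [|k]; first by rewrite expr0 -mpolyC1 mderivC; ring.
  by rewrite derX exprS; ring.
have H0 : C ^+ N * P ^+ d.+1 != 0 by rewrite mulf_neq0 ?expf_neq0.
have [b|a eF] := wronskian_proportional char0 (G := F ^+ d.+1) H0.
  apply: (mulfI C0); apply/eqP; rewrite -subr_eq0 mderivM !derX !exprS; apply/eqP.
  transitivity (C ^+ N * P ^+ d * F ^+ d *
      (d.+1%:R * C * (P * F^`M(b) - F * P^`M(b)) - N%:R * F * P * C^`M(b)) -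
    F * F ^+ d * (P * P ^+ d) * (C * (C ^+ N)^`M(b) - N%:R * C ^+ N * C^`M(b))).
    by ring.
  by rewrite key derCN !subrr !mulr0 subr0.
have eF' : F ^+ d.+1 = P ^+ d.+1 * (a *: C ^+ N).
  by rewrite eF -!mul_mpolyC; ring.
have [phi eP] := dvd_of_dvd_exp P0 eF'.
have ephi : phi ^+ d.+1 = a *: C ^+ N.
  by apply: (mulfI (expf_neq0 d.+1 P0)); rewrite -exprMn -eP.
have [c ec] := closed_root ephi.
by exists c; rewrite eP mulrC !rmorphM /= ec.
Qed.

(** The constants of the Hamiltonian derivations in the localization of the
    quotient at a homogeneous P are scalars.  The lifts of the components of s
    start in a degree above that of P, so that the exponent N above makes sense. *)
Lemma central_fraction p P s : P \is p.-homog -> P != 0 ->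
  (forall a b, pi (P * ham C a b s) = pi (s * ham C a b P)) ->
  exists c : K, pi s = pi (c%:MP * P).
Proof.
move=> hP P0 hs; pose M := maxn (msize s) p.
have [F [hF eF]] := level_graded_repr hC hom lambda0
  (leq_trans (leq_maxl (msize s) p) (leqnSn _)).
rewrite -/M in hF.
have hF' k : F k \is (M + k).+1.-homog by rewrite -addSn.
have central k : (k < d.+1)%N -> forall a b, P * ham C a b (F k) = F k * ham C a b P.
  move=> kd a b; apply/eqP; rewrite -subr_eq0; apply/eqP; move: k kd.
  apply: (@level_graded_inj _ _ _ _ _ hC hom lambda0 (p + d + M)).
    move=> k; apply: rpredB.
      by rewrite -!addnA; apply: dhomogM (ham_dhomog _ _ (hF' k)).
    case: (p) hP => [|p'] hP'; first by rewrite (ham_dhomog0 _ _ hP') mulr0 dhomog0.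
    have -> : (p'.+1 + d + M + k = (M.+1 + k) + (d + p'))%N by lia.
    by apply: dhomogM; rewrite ?addSn //; apply: ham_dhomog.
  rewrite sumrB -mulr_sumr -mulr_suml !rmorphB !rmorphM /=.
  have -> : \sum_(k < d.+1) ham C a b (F k) = ham C a b (\sum_(k < d.+1) F k).
    by rewrite (derivation_sum (hamD C a b)).
  have := hs a b; rewrite !rmorphM /= => hs'.
  by rewrite -(pi_ham a b eF) -eF hs' subrr.
have /fin_all_exists[c hc] (k : 'I_d.+1) : exists c : K, pi (F k) = pi (c%:MP * P).
  apply: (@homog_central_fraction p (M.+1 + k - p)) => //; last exact: central.
  rewrite subnK // (leq_trans (leq_maxr (msize s) p)) // -/M; lia.
exists (\sum_k c k); rewrite eF rmorph_sum raddf_sum mulr_suml rmorph_sum /=.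
by apply: eq_bigr => k _; rewrite hc.
Qed.

End CentralFraction.

(** * Eliminating one variable from an ideal *)

Lemma mpoly_rmorph_ext (m : nat) (K : fieldType) (S : comNzRingType)
    (f g : {rmorphism {mpoly K[m]} -> S}) :
  (forall c, f c%:MP = g c%:MP) -> (forall i, f 'X_i = g 'X_i) -> f =1 g.
Proof.
move=> fgC fgX p; rewrite [p]mpolyE !rmorph_sum; apply: eq_bigr => k _.
rewrite -mul_mpolyC !rmorphM /= fgC; congr (_ * _).
rewrite mpolyXE_id !rmorph_prod; apply: eq_bigr => i _.
by rewrite !rmorphXn /= fgX.
Qed.

Lemma pseudo_division (T : idomainType) (p q : {poly T}) : q != 0 ->
  exists k g r, lead_coef q ^+ k *: p = g * q + r /\ (size r < size q)%N.
Proof.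
move=> q0; exists (scalp p q), (p %/ q), (p %% q).
by rewrite Pdiv.Idomain.divp_eq ltn_modpN0.
Qed.

(** The quotient by q becomes free over T once the leading coefficient of q is
    inverted, so torsion is killed by a power of that coefficient. *)
Lemma dvd_lead_coef_exp (T : idomainType) (t : T) (p q u : {poly T}) :
  t != 0 -> t%:P * p = q * u -> q != 0 ->
  exists k g, (lead_coef q ^+ k)%:P * p = g * q.
Proof.
move=> t0 et q0; have [k [g [r [e sr]]]] := pseudo_division p q0.
exists k, g; rewrite -mul_polyC in e; rewrite e; set c := _%:P in e.
suff -> : r = 0 by rewrite addr0.
have er : t%:P * r = (c * u - t%:P * g) * q.
  have -> : r = c * p - g * q by rewrite e addrC addKr.
  transitivity (c * (t%:P * p) - t%:P * g * q); first by ring.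
  by rewrite et; ring.
apply/eqP/negPn/negP => r0; have tr0 : t%:P * r != 0 by rewrite mulf_neq0 ?polyC_eq0.
move: tr0; rewrite er mulf_eq0 => /norP[v0 _].
have := size_mul v0 q0; rewrite -er mul_polyC size_scale // => esr.
move: sr; rewrite esr ltnNge => /negP[].
by move: v0; rewrite -size_poly_gt0; case: (size _) => //= a _; rewrite leq_addl.
Qed.

Section OneVariable.
Variables (n : nat) (K : fieldType) (j : 'I_n.+1).
Local Notation R := {mpoly K[n.+1]}.
Local Notation T := {mpoly K[n]}.
Implicit Types (t : T) (q : {poly T}) (f : R).

(** The inclusion of T = K[x_i, i <> j], with its variables renumbered. *)
Definition coef_emb : T -> R := mmap (@mpolyC n.+1 K) (fun k => 'X_(lift j k)).
HB.instance Definition _ := GRing.RMorphism.on coef_emb.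

Definition of_poly : {poly T} -> R := horner_eval 'X_j \o map_poly coef_emb.
HB.instance Definition _ := GRing.RMorphism.on of_poly.

Definition to_poly : R -> {poly T} :=
  mmap (@polyC T \o @mpolyC n K)
    (fun i => oapp (fun k => ('X_k)%:P) 'X (unlift j i)).
HB.instance Definition _ := GRing.RMorphism.on to_poly.

Lemma coef_embM : {morph coef_emb : s t / s * t}.
Proof. exact: rmorphM. Qed.

Lemma of_polyM : {morph of_poly : p q / p * q}.
Proof. exact: rmorphM. Qed.

Lemma of_polyB : {morph of_poly : p q / p - q}.
Proof. exact: rmorphB. Qed.

Lemma of_polyN : {morph of_poly : p / - p}.
Proof. exact: rmorphN. Qed.

Lemma to_polyM : {morph to_poly : f g / f * g}.
Proof. exact: rmorphM. Qed.

Lemma coef_embXn k : {morph coef_emb : t / t ^+ k}.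
Proof. exact: rmorphXn. Qed.

Lemma coef_embX k : coef_emb 'X_k = 'X_(lift j k).
Proof. by rewrite /coef_emb mmapX mmap1U. Qed.

Lemma coef_embC c : coef_emb c%:MP = c%:MP.
Proof. exact: mmapC. Qed.

Lemma to_polyX i : to_poly 'X_i = oapp (fun k => ('X_k)%:P) 'X (unlift j i).
Proof. by rewrite /to_poly mmapX mmap1U. Qed.

Lemma to_polyC c : to_poly c%:MP = c%:MP%:P.
Proof. exact: mmapC. Qed.

Lemma of_polyC t : of_poly t%:P = coef_emb t.
Proof. by rewrite /of_poly /= map_polyC /= /horner_eval hornerC. Qed.

Lemma of_polyX : of_poly 'X = 'X_j.
Proof. by rewrite /of_poly /= map_polyX /horner_eval hornerX. Qed.

Lemma to_polyK : cancel to_poly of_poly.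
Proof.
apply: (@mpoly_rmorph_ext _ _ _ (of_poly \o to_poly) idfun) => [c|i] /=.
  by rewrite to_polyC of_polyC coef_embC.
rewrite to_polyX; case: (unliftP j i) => [k|] -> /=.
  by rewrite of_polyC coef_embX.
by rewrite of_polyX.
Qed.

Lemma to_poly_coef_emb t : to_poly (coef_emb t) = t%:P.
Proof.
apply: (@mpoly_rmorph_ext _ _ _ (to_poly \o coef_emb) (@polyC T)) => [c|i] /=.
  by rewrite coef_embC to_polyC.
by rewrite coef_embX to_polyX liftK.
Qed.

Lemma of_polyK : cancel of_poly to_poly.
Proof.
elim/poly_ind => [|q t IH]; first by rewrite !rmorph0.
rewrite !rmorphD !rmorphM /= IH of_polyX of_polyC to_poly_coef_emb to_polyX.
by rewrite unlift_none.
Qed.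

Lemma mderiv_coef_emb t : (coef_emb t)^`M(j) = 0.
Proof.
rewrite [t]mpolyE rmorph_sum (derivation_sum (mderivD j)) big1 // => k _.
rewrite -mul_mpolyC rmorphM /= coef_embC mderiv_mulC.
rewrite mpolyXE_id rmorph_prod (_ : (_)^`M(j) = 0) ?mulr0 //.
apply: (big_ind (fun f : R => f^`M(j) = 0)) => [|f g df dg|i _].
- by rewrite -mpolyC1 mderivC.
- by rewrite mderivM df dg mul0r mulr0 addr0.
rewrite rmorphXn /= coef_embX; elim: (k i) => [|e IH].
  by rewrite expr0 -mpolyC1 mderivC.
rewrite exprS mderivM IH mderivXU eq_sym (negPf (neq_lift _ _)).
by rewrite mul0r mulr0 addr0.
Qed.

Lemma mderiv_of_poly q : (of_poly q)^`M(j) = of_poly q^`().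
Proof.
elim/poly_ind: q => [|q t IH]; first by rewrite deriv0 !rmorph0 mderiv0.
rewrite derivD derivM derivX derivC addr0 mulr1 !rmorphD !rmorphM /= of_polyX.
by rewrite of_polyC mderivD mderivM IH mderiv_coef_emb mderivXU eqxx mulr1 addr0.
Qed.

Lemma coef_emb_eq0 t : (coef_emb t == 0) = (t == 0).
Proof.
apply/eqP/eqP => [e|->]; last exact: rmorph0.
by apply: polyC_inj; rewrite -to_poly_coef_emb e rmorph0.
Qed.

Lemma of_poly_eq0 q : (of_poly q == 0) = (q == 0).
Proof.
apply/eqP/eqP => [e|->]; last exact: rmorph0.
by rewrite -[q]of_polyK e rmorph0.
Qed.

End OneVariable.

Section Elimination.
Variables (n : nat) (K : fieldType) (C : {mpoly K[n.+1]}) (lambda : K).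
Variables (d : nat) (hC : nonconstant C).
Hypotheses (hom : C \is d.+1.-homog) (lambda0 : lambda != 0).
Hypotheses (char0 : [pchar K] =i pred0).
Variable j : 'I_n.+1.
Hypothesis Cj : C^`M(j) != 0.
Local Notation R := {mpoly K[n.+1]}.
Local Notation T := {mpoly K[n]}.
Local Notation pi := (level_proj lambda hC).
Local Notation emb := (coef_emb j).
Local Notation ofp := (of_poly j).
Local Notation top := (to_poly j).

Lemma natr_neq0 k : k.+1%:R != 0 :> R.
Proof. by rewrite -mpolyC_nat mpolyC_eq0 ((pcharf0P K).1 char0). Qed.

(** Torsion is killed by a power of the leading coefficient of C - lambda in x_j.
    Up to a factorial this coefficient is an iterated derivative of C, because C
    has positive degree in x_j; so it is homogeneous, hence regular. *)
Lemma torsion_free (t : T) f : t != 0 -> pi (emb t * f) = 0 -> pi f = 0.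
Proof.
move=> t0 /pi_eq0P[u].
have [L eL] : exists L, L = C - lambda%:MP by eexists.
rewrite -eL => eu.
have dL : L^`M(j) = C^`M(j) by rewrite eL mderivB mderivC subr0.
have [q eq] : exists q, L = ofp q by exists (top L); rewrite to_polyK.
have q0 : q != 0 by rewrite -(of_poly_eq0 j) -eq eL subr_eq0; exact: hC.
have [r sr] : exists r, size q = r.+2.
  case E : (size q) => [|[|r]]; last by exists r.
    by move/eqP: E; rewrite size_poly_eq0 (negPf q0).
  case/negP: Cj; have /eqP/size_poly1P[c _ ec] := E.
  by rewrite -dL eq ec of_polyC mderiv_coef_emb.
have [c ec] : exists c, c = lead_coef q by eexists.
have c0 : c != 0 by rewrite ec lead_coef_eq0.
have [N hN] : exists N, emb c *+ (r.+1)`! \is N.-homog.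
  have homk k : exists N, iter k (mderiv j) C^`M(j) \is N.-homog.
    elim: k => [|k [N IH]] /=; first by exists d; apply: dhomog_mderiv.
    case: N IH => [|N] IH; last by exists N; apply: dhomog_mderiv.
    exists 0%N; rewrite (_ : mderiv _ _ = 0) ?dhomog0 //.
    apply/mpolyP => l; rewrite mcoeff_mderiv mcoeff0.
    by rewrite (dhomog_nemf_coeff IH) ?mul0rn //= mdegD mdeg1 addn1.
  have [N hN] := homk r; exists N; move: hN.
  rewrite -dL eq mderiv_of_poly.
  have -> k : iter k (mderiv j) (ofp q^`()) = ofp q^`(k.+1).
    by elim: k => //= k ->; rewrite mderiv_of_poly -derivnS.
  have -> : q^`(r.+1) = (c *+ (r.+1)`!)%:P.
    apply/polyP => i; rewrite coef_derivn coefC; case: i => [|i] /=.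
      by rewrite addn0 ffactnn ec lead_coefE sr.
    by rewrite nth_default ?mul0rn // sr addnS ltnS leq_addr.
  by rewrite of_polyC rmorphMn.
have P0 : emb c *+ (r.+1)`! != 0.
  rewrite -mulr_natr mulf_neq0 ?coef_emb_eq0 //.
  by rewrite -(prednK (fact_gt0 r.+1)) natr_neq0.
have et : t%:P * top f = q * top u.
  by move: (congr1 top eu); rewrite eq !to_polyM to_poly_coef_emb of_polyK.
have [k [g]] := dvd_lead_coef_exp t0 et q0.
rewrite -ec => /(congr1 ofp).
rewrite !of_polyM to_polyK of_polyC coef_embXn -eq => ef.
apply: (pi_homog_reg hom lambda0 (dhomogMn k hN) (expf_neq0 k P0)).
apply/pi_eq0P; exists ((r.+1)`!%:R ^+ k * ofp g); rewrite -eL.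
rewrite -(mulr_natr (emb c)) exprMn.
transitivity ((r.+1)`!%:R ^+ k * (emb c ^+ k * f)); first by ring.
by rewrite ef; ring.
Qed.

Lemma size_dvd_const (w y : {poly T}) (k : T) : k != 0 -> k%:P = w * y -> size w = 1.
Proof.
move=> k0 e; have : w * y != 0 by rewrite -e polyC_eq0.
rewrite mulf_eq0 => /norP[w0 y0].
have := size_mul w0 y0; rewrite -e size_polyC k0.
move: w0 y0; rewrite -!size_poly_gt0; case: (size w) (size y) => [|[|a]] [|b] //=.
by rewrite addSn addnS.
Qed.

(** The Jacobian criterion: up to a factor in T, a common factor w of g and h is a
    double factor of C - lambda, so it divides C - lambda and all partial
    derivatives of C, and by Euler's identity the nonzero scalar d lambda. *)
Lemma common_factor_trivial (w g h : {poly T}) (c : T) : c != 0 ->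
  c%:P * top (C - lambda%:MP) = g * h -> w %| g -> w %| h -> size w = 1.
Proof.
move=> c0 + /Pdiv.Idomain.dvdpP[[u g'] /= u0 eg] /Pdiv.Idomain.dvdpP[[v h'] /= v0 eh].
have [L eL] : exists L, L = C - lambda%:MP by eexists.
rewrite -eL -mul_polyC in eg eh * => ec; rewrite -mul_polyC in eh.
have [t0 t0E] : exists t0, t0 = u * v * c by eexists.
have t0_neq0 : t0 != 0 by rewrite t0E !mulf_neq0.
have [tau etau] : exists tau, tau = emb t0 by eexists.
have [W eW] : exists W, W = ofp w by eexists.
have [G eG] : exists G, tau * L = W * W * G.
  exists (ofp (g' * h')); rewrite etau eW -[L in LHS](to_polyK j) -of_polyC.
  rewrite -!of_polyM; congr (ofp _); rewrite t0E !polyCM.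
  transitivity (u%:P * v%:P * (c%:P * top L)); first by ring.
  rewrite ec; transitivity ((u%:P * g) * (v%:P * h)); first by ring.
  by rewrite eg eh; ring.
have dC i : exists Z, tau ^+ 2 * C^`M(i) = W * Z.
  have : (tau * L)^`M(i) = (W * W * G)^`M(i) by rewrite eG.
  have dL : L^`M(i) = C^`M(i) by rewrite eL mderivB mderivC subr0.
  rewrite !mderivM dL => e.
  exists (tau * (2%:R * W^`M(i) * G + W * G^`M(i)) - tau^`M(i) * W * G).
  apply/eqP; rewrite -subr_eq0; apply/eqP.
  transitivity (tau * (tau^`M(i) * L + tau * C^`M(i) -
      ((W^`M(i) * W + W * W^`M(i)) * G + W * W * G^`M(i))) -
    tau^`M(i) * (tau * L - W * W * G)); first by ring.
  by rewrite e eG !subrr !mulr0 subr0.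
have [Z hZ] := fin_all_exists dC.
have [Y eY] : exists Y, emb (t0 ^+ 2 * (d.+1%:R * lambda)%:MP) = W * Y.
  exists (\sum_i 'X_i * Z i - d.+1%:R * tau * W * G).
  rewrite coef_embM coef_embXn coef_embC mpolyCM mpolyC_nat -etau.
  rewrite mulrBr mulr_sumr.
  under eq_bigr => i _ do rewrite mulrCA -hZ mulrCA.
  rewrite -mulr_sumr (euler hom) -mul_mpolyC mpolyC_nat.
  transitivity (tau ^+ 2 * (d.+1%:R * C) - d.+1%:R * tau * (tau * L)).
    by rewrite eL; ring.
  by rewrite eG; ring.
move/(congr1 top): eY; rewrite to_poly_coef_emb to_polyM eW of_polyK.
apply: size_dvd_const; rewrite mulf_neq0 ?expf_neq0 // mpolyC_eq0 mulf_neq0 //.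
by rewrite ((pcharf0P K).1 char0).
Qed.

(** Let g generate the extension of I to Frac T [x_j], and let g h be C - lambda
    up to a factor in T.  Since g and h are coprime, t = u g + v h for some t in T,
    and s = u g acts on multiples of g as t does, modulo g h. *)
Lemma elimination (I : level_quot lambda hC -> Prop) : is_ideal I ->
  exists (t : T) s, [/\ t != 0, I (pi s) &
    forall f, I (pi f) -> pi (s * f) = pi (emb t * f)].
Proof.
move=> [I0 ID IM].
have [L eL] : exists L, L = C - lambda%:MP by eexists.
have IN x : I x -> I (- x) by move=> Ix; rewrite -mulN1r; apply: IM.
have piL : pi L = 0 by apply/pi_eq0P; exists 1; rewrite mulr1.
have L0 : top L != 0.
  by rewrite -(of_poly_eq0 j) to_polyK eL subr_eq0; exact: hC.
pose J q := I (pi (ofp q)).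
have JB p q : J p -> J q -> J (p - q).
  by move=> Jp Jq; rewrite /J of_polyB rmorphB; apply: ID => //; apply: IN.
have JM p q : J q -> J (p * q).
  by move=> Jq; rewrite /J of_polyM rmorphM; apply: IM.
have JL : J (top L) by rewrite /J to_polyK piL.
pose Q N := `[< exists q, [/\ q != 0, J q & size q = N] >].
have exQ : exists N, Q N by exists (size (top L)); apply/asboolP; exists (top L).
have [N /asboolP[g [g0 Jg sg]] gmin] := ex_minnP exQ.
have red q : J q -> exists2 c, c != 0 & exists h, c%:P * q = h * g.
  move=> Jq; have [k [h [r [e sr]]]] := pseudo_division q g0.
  exists (lead_coef g ^+ k); first by rewrite expf_neq0 ?lead_coef_eq0.
  exists h; rewrite mul_polyC e; suff -> : r = 0 by rewrite addr0.
  apply/eqP/negPn/negP => r0; move: sr.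
  rewrite sg ltnNge gmin //; apply/asboolP; exists r; split=> //.
  have -> : r = lead_coef g ^+ k *: q - h * g by rewrite e addrC addKr.
  by rewrite -mul_polyC; apply: JB; apply: JM.
have [c c0 [h eh]] := red _ JL.
have cop : coprimep g h.
  rewrite coprimep_def; apply/eqP; rewrite [RHS]mulrC eL in eh.
  exact: common_factor_trivial c0 eh (dvdp_gcdl _ _) (dvdp_gcdr _ _).
have [[u v] /= /eqpP[[a b] /= /andP[a0 b0]]] := Bezout_coprimepP _ _ cop.
rewrite -!mul_polyC mulr1 => eb.
exists b, (ofp (a%:P * u * g)); split=> // [|f If]; first exact: JM.
have Jf : J (top f) by rewrite /J to_polyK.
have [c1 c10 [h1 eh1]] := red _ Jf.
apply/eqP; rewrite -subr_eq0 -rmorphB; apply/eqP/(torsion_free c10)/pi_eq0P.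
exists (- ofp (a%:P * v * h1 * c%:P)); rewrite -eL.
suff : c1%:P * ((a%:P * u * g) * top f - b%:P * top f) =
    - (a%:P * v * h1 * c%:P * top L).
  move=> e; transitivity (ofp (c1%:P * ((a%:P * u * g) * top f - b%:P * top f))).
    by rewrite of_polyM of_polyB [ofp (_ * top f)]of_polyM [ofp (b%:P * _)]of_polyM
      to_polyK !of_polyC.
  by rewrite e of_polyN of_polyM to_polyK mulrN mulrC.
transitivity ((a%:P * u * g - b%:P) * (c1%:P * top f)); first by ring.
transitivity (- (a%:P * v * h1 * (c%:P * top L))); last by ring.
by rewrite eh eh1 -eb; ring.
Qed.

End Elimination.

(** * Ideals stable under the Hamiltonian derivations *)

Section StableIdeals.
Variables (m : nat) (K : fieldType) (C : {mpoly K[m]}).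
Hypothesis char0 : [pchar K] =i pred0.
Local Notation R := {mpoly K[m]}.

Lemma msize_mderiv_lt i (f : R) : f^`M(i) != 0 -> (msize f^`M(i) < msize f)%N.
Proof.
move=> nz; rewrite -(mlead_deg nz).
have := mlead_supp nz; rewrite mcoeff_msupp mcoeff_mderiv => lc.
have : f@_(mlead f^`M(i) + U_(i)) != 0.
  by apply: contraNneq lc => ->; rewrite mul0rn.
by rewrite -mcoeff_msupp => /msize_mdeg_lt; rewrite mdegD mdeg1 addn1.
Qed.

Lemma mderiv_eq0_const (f : R) : (forall i, f^`M(i) = 0) -> exists a, f = a%:MP.
Proof.
move=> df; have [i|a ->] := wronskian_proportional char0 (G := f) (oner_neq0 R).
  by rewrite df -mpolyC1 mderivC !mulr0.
by exists a; rewrite -mul_mpolyC mulr1.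
Qed.

Lemma mulr_ham_exp a b k (f : R) :
  f * ham C a b (f ^+ k) = k%:R * f ^+ k * ham C a b f.
Proof.
elim: k => [|k IH]; first by rewrite expr0 -mpolyC1 hamC; ring.
by rewrite exprS hamM mulrDr mulrCA IH -(natr1 k); ring.
Qed.

(** The h killed by d_j such that C_j^k h lies in W for some k are stable under
    every d_b, because D_jb h = C_j h_b for such h.  A nonzero one of least degree
    is then a constant. *)
Lemma stable_ideal_power (W : R -> Prop) j r :
  is_ideal W -> (forall b f, W f -> W (ham C j b f)) ->
  r != 0 -> r^`M(j) = 0 -> W r -> exists k, W (C^`M(j) ^+ k).
Proof.
move=> [W0 WD WM] Wham r0 dr Wr; set P := C^`M(j).
have WB f g : W f -> W g -> W (f - g).
  by move=> Wf Wg; apply: WD => //; rewrite -mulN1r; apply: WM.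
pose Q N := `[< exists h k, [/\ h != 0, h^`M(j) = 0, W (P ^+ k * h) & msize h = N] >].
have exQ : exists N, Q N.
  by exists (msize r); apply/asboolP; exists r, 0%N; rewrite expr0 mul1r.
have [N /asboolP[h [k [h0 dh Wh sh]]] hmin] := ex_minnP exQ.
have dhb b : h^`M(b) = 0.
  apply/eqP/negPn/negP => nz; have := msize_mderiv_lt nz.
  rewrite sh ltnNge hmin //; apply/asboolP; exists h^`M(b), k.+2; split=> //.
    by rewrite mderiv_comm dh mderiv0.
  have hamh : ham C j b h = P * h^`M(b) by rewrite /ham dh mulr0 subr0.
  have -> : P ^+ k.+2 * h^`M(b) =
      P * ham C j b (P ^+ k * h) - (k%:R * ham C j b P) * (P ^+ k * h).
    rewrite hamM hamh mulrDr mulrA mulr_ham_exp !exprS; ring.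
  by apply: WB; apply: WM => //; apply: Wham.
have [a ea] := mderiv_eq0_const dhb; exists k.
have a0 : a != 0 by rewrite -(mpolyC_eq0 m) -ea.
have -> : P ^+ k = (a^-1)%:MP * (P ^+ k * h); last exact: WM.
by rewrite ea mulrCA -mpolyCM mulVf // mpolyC1 mulr1.
Qed.

End StableIdeals.

Section Radical.
Variables (S : comNzRingType) (I : S -> Prop).
Hypothesis idI : is_ideal I.

Definition radical x := exists k, I (x ^+ k).

Lemma ideal_sum (J : Type) (s : seq J) (Q : pred J) (F : J -> S) :
  (forall i, Q i -> I (F i)) -> I (\sum_(i <- s | Q i) F i).
Proof.
by move=> hF; apply: big_ind => //; [exact: (ideal_0 idI)|exact: (ideal_D idI)].
Qed.

Lemma radical0 : radical 0.
Proof. by exists 1; rewrite expr1; apply: (ideal_0 idI). Qed.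

Lemma radicalM a x : radical x -> radical (a * x).
Proof. by move=> [k Ik]; exists k; rewrite exprMn; apply: (ideal_M idI). Qed.

Lemma radicalD x y : radical x -> radical y -> radical (x + y).
Proof.
move=> [k Ik] [l Il]; exists (k + l)%N; rewrite exprDn; apply: ideal_sum => i _.
rewrite -mulr_natl; apply: (ideal_M idI); have [li|il] := leqP l i.
  by rewrite -(subnK li) exprD mulrA; apply: (ideal_M idI).
by rewrite -addnBA ?(ltnW il) // exprD mulrC mulrCA mulrC; apply: (ideal_M idI).
Qed.

Lemma radical_sum (J : Type) (s : seq J) (Q : pred J) (F : J -> S) :
  (forall i, Q i -> radical (F i)) -> radical (\sum_(i <- s | Q i) F i).
Proof. by move=> hF; apply: big_ind => //; [exact: radical0|exact: radicalD]. Qed.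

End Radical.

Section Simple.
Variables (n : nat) (K : fieldType) (C : {mpoly K[n.+1]}) (lambda : K).
Variables (d : nat) (hC : nonconstant C).
Hypotheses (hom : C \is d.+1.-homog) (lambda0 : lambda != 0).
Hypotheses (char0 : [pchar K] =i pred0) (hclosed : closed_mpoly C).
Local Notation R := {mpoly K[n.+1]}.
Local Notation A := (level_quot lambda hC).
Local Notation pi := (level_proj lambda hC).

Variable I : A -> Prop.
Hypothesis idI : is_ideal I.
Hypothesis stableI : forall a b (f : R), I (pi f) -> I (pi (ham C a b f)).

Lemma piM : {morph pi : f g / f * g}. Proof. exact: rmorphM. Qed.
Lemma piD : {morph pi : f g / f + g}. Proof. exact: rmorphD. Qed.

(** The r whose multiplication map on I is that by an element of I.  They
    form the preimage of the sum of I and its annihilator; in this form the set is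
    visibly stable. *)
Definition acts_on_ideal (r : R) :=
  exists2 s, I (pi s) & forall f, I (pi f) -> pi (s * f) = pi (r * f).

Lemma acts_on_ideal_ideal : is_ideal acts_on_ideal.
Proof.
split.
- by exists 0; rewrite ?rmorph0; first exact: (ideal_0 idI).
- move=> r r' [s Is hs] [s' Is' hs']; exists (s + s').
    by rewrite piD; apply: (ideal_D idI).
  by move=> f If; rewrite !mulrDl !piD hs ?hs'.
- move=> a r [s Is hs]; exists (a * s).
    by rewrite piM; apply: (ideal_M idI).
  by move=> f If; rewrite -!mulrA !(piM a) hs.
Qed.

Lemma acts_on_ideal_ham a b r : acts_on_ideal r -> acts_on_ideal (ham C a b r).
Proof.
move=> [s Is hs]; exists (ham C a b s); first exact: stableI.
move=> f If; have := pi_ham a b (hs f If).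
by rewrite !hamM !piD (hs _ (stableI a b If)) => /addIr.
Qed.

(** For s and C_j^k acting in the same way on I, deriving s^2 = C_j^k s shows that
    s / C_j^k is killed by the Hamiltonian derivations. *)
Lemma partial_power_or_zero j :
  (exists k, I (pi (C^`M(j) ^+ k))) \/ (forall f, I (pi f) -> pi f = 0).
Proof.
set P := C^`M(j); have [P0|P0] := eqVneq P 0.
  by left; exists 1; rewrite P0 expr1 rmorph0; exact: (ideal_0 idI).
have [t [s0 [t0 Is0 hs0]]] := elimination hom lambda0 char0 P0 idI.
have [k [s Is hs]] : exists k, acts_on_ideal (P ^+ k).
  apply: (stable_ideal_power char0 acts_on_ideal_ideal
    (fun b f => @acts_on_ideal_ham j b f)
    (r := coef_emb j t)).
  - by rewrite coef_emb_eq0.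
  - exact: mderiv_coef_emb.
  - by exists s0.
have hP : P ^+ k \is (d * k).-homog by apply/dhomogMn/dhomog_mderiv.
have Pk0 : P ^+ k != 0 by rewrite expf_neq0.
have [c ec] : exists c : K, pi s = pi (c%:MP * P ^+ k).
  apply: (central_fraction hom lambda0 char0 hclosed hP Pk0) => a b.
  have es := hs _ (stableI a b Is).
  have := pi_ham a b (hs s Is); rewrite !hamM !piD es => /addIr.
  by rewrite [ham C a b s * s]mulrC es [ham C a b (P ^+ k) * s]mulrC.
have [c0|c0] := eqVneq c 0; [right|left].
  move=> f If; apply: (pi_homog_reg hom lambda0 hP Pk0).
  by rewrite -hs // piM ec c0 mpolyC0 mul0r rmorph0 mul0r.
exists k; have -> : P ^+ k = (c^-1)%:MP * (c%:MP * P ^+ k).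
  by rewrite mulrA -mpolyCM mulVf // mpolyC1 mul1r.
by rewrite piM -ec; apply: (ideal_M idI).
Qed.

(** If I <> 0, every C_j is nilpotent modulo I, hence so is
    sum_j x_j C_j = d lambda, a unit. *)
Lemma stable_ideal_trivial : (forall x, I x -> x = 0) \/ (forall x, I x).
Proof.
have [[f [If f0]]|allf] := pselect (exists f, I (pi f) /\ pi f <> 0); last first.
  left=> x Ix; have [f ef] := pi_surj x; rewrite ef in Ix *.
  by apply: contrapT => f0; apply: allf; exists f.
right=> x; rewrite -[x]mulr1; apply: (ideal_M idI).
have rad j : radical I (pi (C^`M(j))).
  have [[k Ik]|/(_ f If)//] := partial_power_or_zero j.
  by exists k; rewrite -rmorphXn.
have [k] : radical I (pi (d.+1%:R * lambda)%:MP).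
  have <- : pi (\sum_j 'X_j * C^`M(j)) = pi (d.+1%:R * lambda)%:MP.
    by rewrite (euler hom) -mul_mpolyC piM pi_C -piM -mpolyCM.
  rewrite rmorph_sum; apply: (radical_sum idI) => j _ /=.
  rewrite piM.
  exact: (radicalM idI).
set c := d.+1%:R * lambda; move=> Ik.
have c0 : c != 0 by rewrite mulf_neq0 // ((pcharf0P K).1 char0).
have -> : 1 = pi (c^-1 ^+ k)%:MP * pi c%:MP ^+ k.
  by rewrite -rmorphXn -piM -rmorphXn -mpolyCM -exprMn mulVf // expr1n mpolyC1 rmorph1.
exact: (ideal_M idI).
Qed.

End Simple.

(** * The centre and the Poisson ideals of the quotient *)

Lemma dhomog0_const (m : nat) (K : fieldType) (C : {mpoly K[m]}) :
  C \is 0.-homog -> C = (C@_0)%:MP.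
Proof.
move=> hC; apply/mpolyP => k; rewrite mcoeffC.
have [->|k0] := eqVneq 0%MM k; first by rewrite mulr1.
by rewrite mulr0 (dhomog_nemf_coeff hC) //= mdeg_eq0 eq_sym.
Qed.

Section Brackets.
Variables (p : nat) (K : fieldType) (C : {mpoly K[p.+2]}) (lambda : K).
Variable hC : nonconstant C.
Hypothesis char0 : [pchar K] =i pred0.
Local Notation R := {mpoly K[p.+2]}.
Local Notation A := (level_quot lambda hC).
Local Notation pi := (level_proj lambda hC).
Local Notation br := (@S_bracket p.+1 K C lambda hC).

Lemma S_bracket_ham a b : a != b ->
  exists (u : {ffun 'I_p.+1 -> A}) (e : bool),
    forall f, br (setarg u ord_max (pi f)) = (-1) ^+ e * pi (ham C a b f).
Proof.
move=> /(P_bracket_ham C)[u [e hu]]; exists (pi_ffun lambda hC u), e => f.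
by rewrite setarg_pi_ffun S_bracket_pi hu rmorphM rmorph_sign.
Qed.

Lemma ham_diag a (f : R) : ham C a a f = 0.
Proof. by rewrite /ham subrr. Qed.

(** Centrality is about the first slot, the Hamiltonian derivations about the
    last one; skew-symmetry exchanges them. *)
Lemma center_ham (x : A) f : x = pi f -> in_center br x ->
  forall a b, pi (ham C a b f) = 0.
Proof.
move=> -> cx a b; have [->|ab] := eqVneq a b; first by rewrite ham_diag rmorph0.
have [u [e hu]] := S_bracket_ham ab.
have skew := br_skew (S_bracket_nLiePoisson lambda hC char0).
pose v := setarg u ord_max (pi f).
have := skew v (tperm ord0 ord_max).
have -> : [ffun i => v (tperm ord0 ord_max i)] =
    setarg [ffun i => v (tperm ord0 ord_max i)] ord0 (pi f).
  apply/ffunP => i; rewrite [LHS]ffunE [RHS]ffunE; case: eqP => [->|_].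
    by rewrite tpermL /v ffunE eqxx.
  by rewrite [RHS]ffunE.
rewrite cx // hu => /esym/eqP.
by rewrite !mulr_sign; do 2 case: ifP => _; rewrite ?oppr_eq0 => /eqP.
Qed.

Lemma const_in_center (a : K) : in_center br a%:A.
Proof.
move=> u i0 _; have [f ->] := pi_ffun_surj u.
have -> : a%:A = pi a%:MP by rewrite -[RHS]mulr1.
rewrite setarg_pi_ffun S_bracket_pi P_bracket_setarg det_jac_set_entry.
by rewrite big1 ?rmorph0 // => j _; rewrite mderivC mul0r.
Qed.

End Brackets.

Theorem theorem1 (K : fieldType) (charK : [pchar K] =i pred0)
    (n : nat) (hn : (2 <= n)%N) (lambda : K) (hlambda : lambda != 0)
    (C : {mpoly K[n.+1]}) (hC : nonconstant C)
    (d : nat) (hhom : C \is d.-homog) (hclosed : closed_mpoly C) :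
  [/\ is_nLiePoisson (@S_bracket n K C lambda hC),
      is_central (@S_bracket n K C lambda hC)
    & is_simple (@S_bracket n K C lambda hC)].
Proof.
case: n => [//|p] in hn C hC hhom hclosed *.
case: d hhom => [/dhomog0_const eC|d hom].
  by have := hC C@_0; rewrite -eC eqxx.
split; first exact: S_bracket_nLiePoisson.
- move=> x; split=> [cx|[a ->]]; last exact: const_in_center.
  have [f ef] := pi_surj x.
  have hom1 : (1 : {mpoly K[p.+2]}) \is 0.-homog by exact: dhomog1.
  have [c ec] : exists c : K,
      level_proj lambda hC f = level_proj lambda hC (c%:MP * 1).
    apply: (central_fraction hom hlambda charK hclosed hom1 (oner_neq0 _)).
    move=> a b; rewrite mul1r (center_ham charK ef cx).
    by rewrite -mpolyC1 hamC mulr0 rmorph0.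
  by exists c; rewrite ef ec mulr1 -[LHS]mulr1.
- move=> I idI stableI; apply: (stable_ideal_trivial hom hlambda charK hclosed idI).
  move=> a b f If; have [->|ab] := eqVneq a b.
    by rewrite ham_diag rmorph0; exact: (ideal_0 idI).
  have [u [e hu]] := S_bracket_ham lambda hC ab.
  have := stableI (setarg u ord_max (level_proj lambda hC f)) ord_max erefl.
  rewrite hu ffunE eqxx => /(_ If)/(ideal_M idI ((-1) ^+ e)).
  by rewrite mulrA -expr2 sqrr_sign mul1r.
Qed.
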